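(* The class of $(P_5,\overline{P_5},Bull)$-sparse graphs has bounded clique-width: there exists a constant $k$ such that every $(P_5,\overline{P_5},Bull)$-sparse graph has clique-width at most $k$.
   Context: All graphs are finite, simple and undirected. $P_5$ is the chordless path on $5$ vertices, $\overline{P_5}$ its complement, and the Bull is the graph on $\{1,2,3,4,5\}$ with edges $12,23,34,25,35$. A graph $G$ is $(P_5,\overline{P_5},Bull)$-sparse if every set of $6$ vertices of $G$ contains at most one $5$-element subset inducing a graph isomorphic to $P_5$, $\overline{P_5}$ or the Bull. The clique-width of a graph is the minimum number of labels needed to construct it using the operations: creation of a single vertex with label $i$; disjoint union of two labelled graphs; adding all edges between the vertices labelled $i$ and the vertices labelled $j$ ($i\ne j$); and relabelling all vertices of label $i$ to label $j$. *)

(* Defs.v *)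
From mathcomp Require Import all_boot.
From mathcomp Require Import boolp.

Set Implicit Arguments.
Unset Strict Implicit.
Unset Printing Implicit Defensive.

Record sgraph := SGraph {
  vertex :> finType;
  adj : rel vertex;
  adj_sym : symmetric adj;
  adj_irr : irreflexive adj }.

Definition iso (G H : sgraph) : Prop :=
  exists2 f : G -> H, bijective f & forall x y, adj (f x) (f y) = adj x y.

Section Induced.
Variables (G : sgraph) (A : {set G}).
Definition induced_adj : rel {x : G | x \in A} := relpre val (@adj G).
Lemma induced_sym : symmetric induced_adj.
Proof. by move=> x y; apply: adj_sym. Qed.
Lemma induced_irr : irreflexive induced_adj.
Proof. by move=> x; apply: adj_irr. Qed.
Definition induced : sgraph := SGraph induced_sym induced_irr.
End Induced.

Section Complement.
Variable G : sgraph.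
Definition compl_adj : rel G := [rel x y | (x != y) && ~~ adj x y].
Lemma compl_sym : symmetric compl_adj.
Proof. by move=> x y; rewrite /compl_adj /= eq_sym adj_sym. Qed.
Lemma compl_irr : irreflexive compl_adj.
Proof. by move=> x; rewrite /compl_adj /= eqxx. Qed.
Definition compl : sgraph := SGraph compl_sym compl_irr.
End Complement.

(* The graph on {1, ..., n} with a given list of edges; vertex i is encoded as
   the ordinal i - 1. *)
Section EdgeList.
Variables (n : nat) (E : seq (nat * nat)).
Definition el_adj : rel 'I_n :=
  [rel i j : 'I_n | (i != j) && (((i.+1, j.+1) \in E) || ((j.+1, i.+1) \in E))].
Lemma el_sym : symmetric el_adj.
Proof. by move=> i j; rewrite /el_adj /= eq_sym orbC. Qed.
Lemma el_irr : irreflexive el_adj.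
Proof. by move=> i; rewrite /el_adj /= eqxx. Qed.
Definition edge_list_graph : sgraph := SGraph el_sym el_irr.
End EdgeList.

Definition P5 : sgraph :=
  edge_list_graph 5 [:: (1, 2); (2, 3); (3, 4); (4, 5)].
Definition Bull : sgraph :=
  edge_list_graph 5 [:: (1, 2); (2, 3); (3, 4); (2, 5); (3, 5)].

Definition induces_P5_coP5_Bull (G : sgraph) (A : {set G}) : Prop :=
  [\/ iso (induced A) P5, iso (induced A) (compl P5) | iso (induced A) Bull].

Definition P5_coP5_Bull_sparse (G : sgraph) : Prop :=
  forall S : {set G}, #|S| = 6 ->
  forall A B : {set G},
    A \subset S -> #|A| = 5 -> induces_P5_coP5_Bull A ->
    B \subset S -> #|B| = 5 -> induces_P5_coP5_Bull B ->
    A = B.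

Record lgraph (k : nat) := LGraph {
  lg_graph :> sgraph;
  lab : lg_graph -> 'I_k }.

Section Operations.
Variable k : nat.
Implicit Types (i j : 'I_k) (G H : lgraph k).

Definition unit_adj : rel unit := fun _ _ => false.
Lemma unit_adj_sym : symmetric unit_adj. Proof. by []. Qed.
Lemma unit_adj_irr : irreflexive unit_adj. Proof. by []. Qed.
Definition lg_vertex i : lgraph k :=
  @LGraph k (SGraph unit_adj_sym unit_adj_irr) (fun=> i).

Definition union_adj G H : rel (G + H)%type := fun u v =>
  match u, v with
  | inl x, inl y => adj x y
  | inr x, inr y => adj x y
  | _, _ => false
  end.
Lemma union_sym G H : symmetric (@union_adj G H).
Proof. by move=> [x|x] [y|y] //=; apply: adj_sym. Qed.
Lemma union_irr G H : irreflexive (@union_adj G H).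
Proof. by move=> [x|x] /=; apply: adj_irr. Qed.
Definition lg_union G H : lgraph k :=
  @LGraph k (SGraph (@union_sym G H) (@union_irr G H))
    (fun u => match u with inl x => lab x | inr y => lab y end).

Definition join_adj i j G : rel G := [rel x y |
  [|| adj x y, (lab x == i) && (lab y == j) | (lab x == j) && (lab y == i)]].
Lemma join_sym i j G : symmetric (@join_adj i j G).
Proof.
move=> x y; rewrite /join_adj /= adj_sym; congr (_ || _).
by rewrite orbC [(lab x == j) && _]andbC [(lab x == i) && _]andbC.
Qed.
Lemma join_irr i j (ij : i != j) G : irreflexive (@join_adj i j G).
Proof.
move=> x; rewrite /join_adj /= adj_irr /=.
by case: (lab x =P i) => [->|]; rewrite ?(negPf ij) ?andbF.
Qed.
Definition lg_join i j (ij : i != j) G : lgraph k :=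
  @LGraph k (SGraph (@join_sym i j G) (join_irr ij (G := G))) (@lab k G).

Definition lg_relabel i j G : lgraph k :=
  @LGraph k G (fun x => if lab x == i then j else lab x).

Inductive constructible : lgraph k -> Prop :=
| constructible_vertex i : constructible (lg_vertex i)
| constructible_union G H :
    constructible G -> constructible H -> constructible (lg_union G H)
| constructible_join i j (ij : i != j) G :
    constructible G -> constructible (lg_join ij G)
| constructible_relabel i j G :
    constructible G -> constructible (lg_relabel i j G).
End Operations.

(* None of the operations yields the graph without vertices; by convention it
   needs no label. *)
Definition cw_constructible (G : sgraph) (k : nat) : Prop :=
  #|G| = 0 \/ exists2 H : lgraph k, constructible H & iso G H.

(* With one label per vertex every graph is constructible, so that the minimum
   defining the clique-width exists. *)
Lemma cw_constructible_card (G : sgraph) : cw_constructible G #|G|.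
Proof.
have [G0|Gpos] := posnP #|G|; first by left.
right.
pose built (s : seq G) (L : seq (G * G)) := exists (H : lgraph #|G|) (h : H -> G),
  [/\ constructible H, injective h, codom h =i s,
      forall x, lab x = enum_rank (h x) &
      forall x y, adj x y = ((h x, h y) \in L) || ((h y, h x) \in L)].
have built_vertex x : built [:: x] [::].
  exists (lg_vertex (enum_rank x)), (fun=> x); split => //.
  - exact: constructible_vertex.
  - by move=> [] [].
  - move=> y; rewrite inE; apply/codomP/eqP => [[_ ->] //|->].
    by exists tt.
have built_seq s : uniq s -> 0 < size s -> built s [::].
  elim: s => // x [|y s] IHs /andP[xs us] _; first exact: built_vertex.
  have [H [h [cH injh codh labh adjh]]] := IHs us isT.
  exists (lg_union (lg_vertex (enum_rank x)) H).
  exists (fun u => match u with inl _ => x | inr z => h z end); split.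
  - by apply: constructible_union cH; apply: constructible_vertex.
  - have hx z : h z <> x.
      by move=> hz; move: xs; rewrite -codh -hz codom_f.
    move=> [[]|a] [[]|b] //.
    + by move=> e; case: (hx b).
    + by move=> e; case: (hx a).
    + by move=> /injh ->.
  - move=> z; rewrite in_cons -codh; apply/codomP/orP.
    + by case=> -[_ ->|a ->]; [left|right; rewrite codom_f].
    + by case=> [/eqP ->|/codomP[a ->]]; [exists (inl tt)|exists (inr a)].
  - by case=> //= z; rewrite labh.
  - by move=> [[]|a] [[]|b] //=; rewrite adjh.
have built_edges L : all (fun p => p.1 != p.2) L -> built (enum G) L.
  elim: L => [_|[u v] L IHL /= /andP[uv /IHL]].
    by apply: built_seq; [apply: enum_uniq|rewrite -cardE].
  move=> [H [h [cH injh codh labh adjh]]].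
  have uv' : enum_rank u != enum_rank v by rewrite (inj_eq enum_rank_inj).
  exists (lg_join uv' H), h; split => //; first exact: constructible_join.
  move=> x y; rewrite -[adj x y]/(@join_adj _ (enum_rank u) (enum_rank v) H x y).
  rewrite /join_adj /= adjh !labh !(inj_eq enum_rank_inj) !in_cons !xpair_eqE.
  rewrite [(h x == v) && _]andbC.
  case: ((h x, h y) \in L); case: ((h y, h x) \in L);
    by rewrite ?orbT ?orbF.
have [|H [h [cH injh codh _ adjh]]] :=
  built_edges [seq p <- enum {: G * G} | adj p.1 p.2].
  apply/allP => -[x y]; rewrite mem_filter /= => /andP[xy _].
  by apply: contraTneq xy => ->; rewrite adj_irr.
exists H => //.
have bh : bijective h.
  apply: inj_card_bij => //; rewrite -(card_codom injh).
  by apply/subset_leq_card/subsetP => x _; rewrite codh mem_enum.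
case: (bh) => g hK gK; exists g; first by exists h.
have memE (p : G * G) : (p \in [seq q <- enum {: G * G} | adj q.1 q.2]) = adj p.1 p.2.
  by rewrite mem_filter mem_enum andbT.
by move=> x y; rewrite adjh !memE !gK /= [adj y x]adj_sym orbb.
Qed.

Lemma ex_cw_constructible (G : sgraph) :
  exists k, (fun k => `[< cw_constructible G k >]) k.
Proof. by exists #|G|; apply/asboolP/cw_constructible_card. Qed.

Definition clique_width (G : sgraph) : nat := ex_minn (ex_cw_constructible G).

(* Main.v *)
Require Import Defs.
From mathcomp Require Import all_boot.
From mathcomp Require Import zify boolp.

Set Implicit Arguments.
Unset Strict Implicit.
Unset Printing Implicit Defensive.

(** Substituting graphs for vertices does not increase the clique-width beyond
    the maximum of the parts, so it suffices to treat graphs without nontrivial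
    module (prime graphs). Apart from C5, the prime graphs on five vertices are
    exactly P5, its complement and the Bull.

    A prime set of at least three vertices that leaves out at least two vertices
    of a prime graph can be enlarged to a prime set by two vertices. If a sparse
    prime graph has a prime subset of five vertices, this growth is a finite
    search: on seven vertices one either reaches a spider (three paths of length
    two with a common end) or its complement, or else a graph that does not grow
    beyond nine vertices. A maximal spider is the whole graph up to one vertex.
    If there is no prime subset of five vertices, one starts from a P4 and
    reaches a half graph or its complement, and a maximal half graph is the
    whole graph. Half graphs, spiders and their complements are built one vertex
    at a time with four labels. *)

(** * Modules and prime sets *)

(** The obstacle is that a finite search has to control families of unbounded size. This is overcome
    by looking at the vertices outside a half graph or spider. A table restricts the adjacencies of
    such a vertex to each small piece, and overlapping pieces force one global pattern: for half
    graphs the vertex is uniform or a twin of a member, for spiders it sees nothing, everything or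
    only the centre. Primality of the whole graph then leaves just the adjacencies that extend the
    family.

    The class is closed under complement, since P5 and its complement are exchanged and the Bull is
    self-complementary. A flag [c], added modulo two to the adjacency, therefore treats both
    versions of each family in one argument.

    As growth goes through the sizes 5, 7, 9 and may leave one vertex over, a prime graph with a
    prime 5-set but no spider has at most 10 vertices. Graphs this small get one label per vertex,
    and only there are more than four labels spent; 16 is a convenient bound above 10. *)

Section Modules.
Variables (T : finType) (e : rel T).
Hypothesis e_sym : symmetric e.
Implicit Types (S X M : {set T}) (u v x y z : T).

Definition module S M :=
  M \subset S /\ forall x y z, x \in M -> y \in M -> z \in S -> z \notin M -> e z x = e z y.

(** Sets of at most two vertices qualify as well, hence the bounds [2 < #|S|] and [2 < #|X|]
    below. *)
Definition prime_set S := forall M, module S M -> #|M| <= 1 \/ M = S.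

Lemma prime_module_eq S M : prime_set S -> module S M -> 1 < #|M| -> M = S.
Proof. by move=> pS mM cM; case: (pS _ mM) => // c1; move: cM; rewrite ltnNge c1. Qed.

Definition uniform_on X v := forall a b, a \in X -> b \in X -> e v a = e v b.
Definition twin_on X v u := u \in X /\ forall z, z \in X -> z != u -> e v z = e u z.

Lemma prime_module_set2 S u v :
  prime_set S -> 2 < #|S| -> u \in S -> v \in S -> u != v ->
  exists z, [/\ z \in S, z != u, z != v & e z u != e z v].
Proof.
move=> pS cS uS vS uv; apply: contrapT => no.
have E : [set u; v] = S; last by move: cS; rewrite -E cards2 uv.
apply: prime_module_eq => //; last by rewrite cards2 uv.
- split; first by apply/subsetP=> z; rewrite !inE => /orP[] /eqP ->.
  move=> x y z; rewrite !inE => hx hy zS; rewrite negb_or => /andP[zu zv].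
  have E : e z u = e z v.
    by apply/eqP; apply: contrapT => /negP ne; apply: no; exists z.
  by case/orP: hx => /eqP ->; case/orP: hy => /eqP ->.
Qed.

Lemma prime_module_setD1 S u :
  prime_set S -> 2 < #|S| -> u \in S ->
  ~ (forall a b, a \in S -> b \in S -> a != u -> b != u -> e u a = e u b).
Proof.
move=> pS cS uS H.
have cD : #|S :\ u| = #|S|.-1 by rewrite (cardsD1 u S) uS.
have E : S :\ u = S; last by move: uS; rewrite -E !inE eqxx.
apply: prime_module_eq => //; last by lia.
- split; first exact: subsetDl.
  move=> x y z; rewrite !inE => /andP[xu xS] /andP[yu yS] zS.
  rewrite zS andbT negbK => /eqP ->; exact: H.
Qed.

Lemma twin_uniq X v u u' :
  prime_set X -> 2 < #|X| -> twin_on X v u -> twin_on X v u' -> u = u'.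
Proof.
move=> pX cX [uX tu] [uX' tu']; apply/eqP; apply: contrapT => /negP ne.
have [z [zX zu zu' /negP[]]] := prime_module_set2 pX cX uX uX' ne.
by rewrite ![e z _]e_sym -tu // -tu'.
Qed.

Lemma uniform_not_twin X v u :
  prime_set X -> 2 < #|X| -> uniform_on X v -> ~ twin_on X v u.
Proof.
move=> pX cX U [uX tu]; apply: (prime_module_setD1 pX cX uX) => a b aX bX au bu.
by rewrite -!tu //; apply: U.
Qed.


(** A nontrivial module [M] of the enlarged set meets [X] in a module of [X], so in all of [X], in
    one vertex [u] or in nothing. The seven alternatives list the possible [M]: [X], [X] with [x],
    [X] with [y]; then {x,u}, {y,u}, {x,y,u}; finally {x,y}. *)
Lemma prime_pair_failure X x y :
  x \notin X -> y \notin X -> x != y -> prime_set X -> 2 < #|X| ->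
  ~ prime_set (x |: (y |: X)) ->
  [\/ [\/ uniform_on X x /\ uniform_on X y,
          uniform_on X y /\ forall a, a \in X -> e y x = e y a |
          uniform_on X x /\ forall a, a \in X -> e x y = e x a],
      [\/ exists2 u, twin_on X x u & e y x = e y u,
          exists2 u, twin_on X y u & e x y = e x u |
          exists2 u, twin_on X x u & twin_on X y u] |
      forall z, z \in X -> e x z = e y z].
Proof.
move=> xX yX xy pX cX /existsNP[M /not_implyP[[MS MM]]].
move=> /not_orP[/negP]; rewrite -ltnNge => cM neM.
set Z := x |: (y |: X).
have xZ : x \in Z by rewrite !inE eqxx.
have yZ : y \in Z by rewrite !inE eqxx orbT.
have XZ z : z \in X -> z \in Z by rewrite !inE => ->; rewrite !orbT.
have ZE z : z \in Z -> [\/ z = x, z = y | z \in X].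
  by rewrite !inE => /or3P[/eqP|/eqP|] H; [constructor 1|constructor 2|constructor 3].
have XM : module X (M :&: X).
  split; first exact: subsetIr.
  move=> a b z; rewrite !inE => /andP[aM _] /andP[bM _] zX; rewrite zX andbT => zM.
  by apply: MM => //; apply: XZ.
have sym2 a b c : e a c = e b c -> e c a = e c b by rewrite ![e c _]e_sym.
case: (pX _ XM) => [c1|E]; last first.
  have XM' z : z \in X -> z \in M by rewrite -{1}E inE => /andP[].
  have [xM|xM] := boolP (x \in M); have [yM|yM] := boolP (y \in M).
  - case: neM; apply/eqP; rewrite eqEsubset MS /=; apply/subsetP => z /ZE.
    by case=> [->|->|/XM'].
  - constructor 1; constructor 2; split=> [a b aX bX|a aX]; apply: MM => //; exact: XM'.
  - constructor 1; constructor 3; split=> [a b aX bX|a aX]; apply: MM => //; exact: XM'.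
  - constructor 1; constructor 1; split=> a b aX bX; apply: MM => //; exact: XM'.
have [M0|[u]] := set_0Vmem (M :&: X).
  have M2 : M \subset [set x; y].
    apply/subsetP => z zM; rewrite !inE; case: (ZE z (subsetP MS _ zM)) => [->|->|zX].
    - by rewrite eqxx.
    - by rewrite eqxx orbT.
    - by move/setP/(_ z): M0; rewrite !inE zM zX.
  have ME : M = [set x; y].
    by apply/eqP; rewrite eqEcard M2 cards2 xy.
  constructor 3 => z zX; rewrite ![e _ z]e_sym; apply: MM.
  - by rewrite ME !inE eqxx.
  - by rewrite ME !inE eqxx orbT.
  - exact: XZ.
  - by rewrite ME !inE; apply/norP; split; apply: contraTneq zX => ->.
rewrite inE => /andP[uM uX].
have ME z : z \in X -> z != u -> z \notin M.
  move=> zX zu; apply/negP => zM.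
  have : #|[set z; u]| <= #|M :&: X|.
    apply: subset_leq_card; apply/subsetP => w; rewrite !inE.
    by move=> /orP[] /eqP ->; rewrite ?zM ?uM.
  by rewrite cards2 zu; lia.
have tw v : v \in M -> twin_on X v u.
  move=> vM; split => // z zX zu; rewrite ![e _ z]e_sym.
  by apply: MM => //; [exact: XZ|exact: ME].
have [xM|xM] := boolP (x \in M); have [yM|yM] := boolP (y \in M).
- by constructor 2; constructor 3; exists u; apply: tw.
- by constructor 2; constructor 1; exists u; [apply: tw|apply: MM].
- by constructor 2; constructor 2; exists u; [apply: tw|apply: MM].
- have ME2 : M \subset [set u].
    apply/subsetP => z zM; rewrite inE; case: (ZE z (subsetP MS _ zM)) => [E|E|zX].
    + by rewrite -E zM in xM.
    + by rewrite -E zM in yM.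
    + by apply: contraTT zM; apply: ME.
  by move: (subset_leq_card ME2); rewrite cards1; lia.
Qed.

(* Ehrenfeucht-Rozenberg: primality propagates upwards two vertices at a time. *)
Lemma prime_add2 S X :
  prime_set S -> prime_set X -> X \subset S -> 2 < #|X| -> 1 < #|S :\: X| ->
  exists x y, [/\ x \in S :\: X, y \in S :\: X, x != y & prime_set (x |: (y |: X))].
Proof.
move=> pS pX XS cX cSX; apply: contrapT => no.
have fail x y : x \in S :\: X -> y \in S :\: X -> x != y ->
    ~ prime_set (x |: (y |: X)).
  by move=> xS yS xy p; apply: no; exists x, y.
have notX z : z \in S :\: X -> z \notin X by rewrite inE => /andP[].
have inS z : z \in S :\: X -> z \in S by rewrite inE => /andP[].
have XinS z : z \in X -> z \in S by apply: (subsetP XS).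
have [a0 a0X] : exists a0, a0 \in X by apply/card_gt0P; lia.
(* If some outside vertex is uniform on [X], removing all such vertices from [S] leaves a proper
   module: for a uniform [z] and a non-uniform [p], failure of the pair can only mean that [z] sees
   [p] as it sees [X]. *)
have noU v : v \in S :\: X -> ~ uniform_on X v.
  move=> vS Uv.
  pose P := S :\: [set w in S :\: X | `[< uniform_on X w >]].
  have XP : X \subset P.
    apply/subsetP => z zX; rewrite !inE zX /= (subsetP XS) //.
  have vP : v \notin P.
    by rewrite inE; apply/nandP; left; rewrite negbK inE vS; apply/asboolP.
  have E : P = S; last by move: vP; rewrite E inS.
  apply: prime_module_eq => //; last by have := subset_leq_card XP; lia.
  - split; first exact: subsetDl.
    have main z p : z \in S -> z \notin P -> p \in P -> e z p = e z a0.
      move=> zS; rewrite inE zS andbT negbK inE => /andP[zSX /asboolP Uz].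
      rewrite inE => /andP[]; rewrite inE negb_and => pn pS'.
      have [pX'|pX'] := boolP (p \in X); first exact: Uz.
      have pSX : p \in S :\: X by rewrite inE pX'.
      have nUp : ~ uniform_on X p by move: pn; rewrite pSX /= => /asboolP.
      have zp : z != p by apply: contra_not_neq nUp => <-.
      case: (prime_pair_failure (notX _ zSX) pX' zp pX cX (fail _ _ zSX pSX zp)).
      + case=> [[_ /nUp]|[/nUp]|[_ H]] //; exact: H.
      + case=> [[u /(uniform_not_twin pX cX Uz)]|[u [uX _] ->]|[u /(uniform_not_twin pX cX Uz)]] //.
        exact: Uz.
      + by move=> H; case: nUp => a b aX bX; rewrite -!H //; apply: Uz.
    move=> x y z xP yP zS zP; rewrite (main z x) // (main z y) //.
(* Likewise [u] together with all its outside twins would be a proper module. *)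
have noT v u : v \in S :\: X -> ~ twin_on X v u.
  move=> vS tv; have uX : u \in X by case: tv.
  pose M := u |: [set w in S :\: X | `[< twin_on X w u >]].
  have uM : u \in M by rewrite !inE eqxx.
  have vu : v != u by apply: contraTneq uX => <-; apply: notX.
  have vM : v \in M.
    by apply/setU1P; right; rewrite inE vS; apply/asboolP.
  have MX z : z \in X -> z \in M -> z = u.
    by move=> zX; rewrite !inE zX => /orP[/eqP|].
  have E : M = S; last first.
    suff : #|X| <= 1 by lia.
    rewrite -(cards1 u); apply: subset_leq_card; apply/subsetP => z zX.
    by rewrite inE; apply/eqP/MX => //; rewrite E XinS.
  apply: prime_module_eq => //.
  - split.
      by apply/subsetP => z; rewrite !inE => /orP[/eqP ->|/andP[/andP[]]] //; apply: XinS.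
    have main z w : z \in S -> z \notin M -> w \in M -> e z w = e z u.
      move=> zS zM /setU1P[-> //|]; rewrite inE => /andP[wSX /asboolP tw].
      have zu : z != u by apply: contraNneq zM => ->.
      have [zX|zX] := boolP (z \in X).
        by rewrite ![e z _]e_sym; case: tw => _; apply.
      have zSX : z \in S :\: X by rewrite inE zX.
      have ntz : ~ twin_on X z u.
        by move=> t; move/negP: zM; apply; apply/setU1P; right; rewrite inE zSX; apply/asboolP.
      have wz : w != z by apply: contra_not_neq ntz => <-.
      case: (prime_pair_failure (notX _ wSX) zX wz pX cX (fail _ _ wSX zSX wz)).
      + by case=> [[/noU]|[/noU]|[/noU]]; try by [|apply].
      + case=> [[u' /(twin_uniq pX cX tw) <-] //|[u' tz E]|[u' /(twin_uniq pX cX tw) <-]] //.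
        have uu' : u != u' by apply: contra_not_neq ntz => ->.
        have [u'X tz'] := tz; have [_ tw'] := tw.
        by rewrite e_sym E tz' // tw' 1?eq_sym // e_sym.
      + by move=> H; case: ntz; split => // a aX au; rewrite -H //; case: tw => _; apply.
    by move=> x y z xM yM zS zM; rewrite (main z x) // (main z y).
  - have : #|[set u; v]| <= #|M|.
      by apply: subset_leq_card; apply/subsetP => z; rewrite !inE => /orP[] /eqP ->;
        [rewrite eqxx|move: vM; rewrite !inE].
    by rewrite cards2 eq_sym vu; lia.
(* Only the last kind of failure remains: all outside vertices agree on [X], so they form a
   module. *)
have E : S :\: X = S; last by move: (XinS _ a0X); rewrite -E inE a0X.
apply: prime_module_eq => //.
- split; first exact: subsetDl.
  move=> x y z xS yS zS; rewrite !inE zS andbT negbK => zX.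
  have [->//|xy] := eqVneq x y.
  case: (prime_pair_failure (notX _ xS) (notX _ yS) xy pX cX (fail _ _ xS yS xy)).
  + by case=> [[/(noU _ xS)]|[/(noU _ yS)]|[/(noU _ xS)]].
  + by case=> [[u /(noT _ _ xS)]|[u /(noT _ _ yS)]|[u /(noT _ _ xS)]].
  + by move=> H; rewrite ![e z _]e_sym H.
Qed.

(** * Induced P4 in prime sets *)

Definition is_P4 (c : bool) p q r s :=
  [/\ e p q = ~~ c, e q r = ~~ c, e r s = ~~ c &
  [/\ e p r = c, e p s = c & e q s = c]].

Definition has_P4 S := exists c p q r s,
  [/\ p \in S, q \in S, r \in S & s \in S] /\ uniq [:: p; q; r; s] /\ is_P4 c p q r s.

Definition splits S := exists c S1 S2,
  [/\ S = S1 :|: S2, [disjoint S1 & S2], S1 != set0, S2 != set0 &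
      forall x y, x \in S1 -> y \in S2 -> e x y = c].

(** Let [Z] be the part of [S1] that [v] sees with value [c]. If some [n] in [S1] outside [Z] is
    seen with [~~ c] from some [z] in [Z], then [z n v y2] is a P4 up to complement; otherwise [Z]
    splits off from everything else with value [c]. *)
Lemma P4_or_split_mixed S1 S2 v w y2 c :
  v \notin S1 -> v \notin S2 -> [disjoint S1 & S2] ->
  (forall x y, x \in S1 -> y \in S2 -> e x y = c) ->
  w \in S1 -> e v w = c -> y2 \in S2 -> e v y2 = ~~ c ->
  has_P4 (v |: (S1 :|: S2)) \/ splits (v |: (S1 :|: S2)).
Proof.
move=> vS1 vS2 dS cross wS1 ew yS2 ey.
have S12 x : x \in S1 -> x \in S2 -> False.
  by move=> x1 x2; move/pred0P/(_ x): dS; rewrite /= x1 x2.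
pose Z := [set z in S1 | e v z == c].
have [[z [n [zZ nS1 en ez]]]|no] := EM (exists z n, [/\ z \in Z, n \in S1, e v n != c & e z n != c]).
  move: zZ; rewrite inE => /andP[zS1 /eqP evz].
  have neg (a : bool) : a != c -> a = ~~ c by case: a; case: (c).
  left; exists c, z, n, v, y2; split; [|split].
  - by rewrite !inE eqxx zS1 nS1 yS2 !orbT.
  - rewrite /= !inE !negb_or -!andbA; apply/and5P; split.
    + by apply: contraNneq en => <-; rewrite evz.
    + by apply: contraNneq vS1 => <-.
    + by apply/eqP => E; apply: (S12 z); rewrite // E.
    + by apply: contraNneq vS1 => <-.
    + apply/and3P; split=> //; last by apply: contraNneq vS2 => ->.
      by apply/eqP => E; apply: (S12 n); rewrite // E.
  - split; [exact: neg|by rewrite e_sym; apply: neg|exact: ey|split].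
    + by rewrite e_sym.
    + exact: cross.
    + exact: cross.
right; exists c, Z, ((v |: (S1 :|: S2)) :\: Z); split.
- have sub : Z \subset v |: (S1 :|: S2).
    by apply/subsetP => z; rewrite !inE => /andP[-> _]; rewrite orbT.
  by apply/setP => x; rewrite !inE; case: (boolP (x \in S1)) => _ //=; case: (_ == c); rewrite ?orbT.
- by rewrite -setI_eq0; apply/eqP/setP => x; rewrite !inE; case: (_ \in S1); case: (_ == c); rewrite ?andbF.
- by apply/set0Pn; exists w; rewrite !inE wS1 ew eqxx.
- by apply/set0Pn; exists v; rewrite !inE eqxx (negPf vS1).
- move=> x y xZ; rewrite !inE => /andP[yZ].
  have xS1 : x \in S1 by move: xZ; rewrite inE => /andP[].
  case/or3P => [/eqP ->|yS1|yS2']; last exact: cross.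
    by move: xZ; rewrite e_sym inE => /andP[_ /eqP].
  apply/eqP; apply: contrapT => /negP exy; apply: no; exists x, y; split => //.
  by move: yZ; rewrite yS1.
Qed.

(* Seinsche's theorem, with graph and complement treated at once by the flag. *)
Lemma P4_or_split S : 1 < #|S| -> has_P4 S \/ splits S.
Proof.
have [n] := ubnP #|S|; elim: n S => // n IH S Sn cS.
have [v vS] : exists v, v \in S by apply/card_gt0P; lia.
have SE : S = v |: (S :\ v) by rewrite setD1K.
have cS' : #|S| = (#|S :\ v|).+1 by rewrite (cardsD1 v S) vS.
have [c1|c2] := leqP #|S :\ v| 1.
  have /cards1P[w Ew] : #|S :\ v| == 1 by apply/eqP; lia.
  have wv : w != v.
    have : w \in S :\ v by rewrite Ew inE.
    by rewrite !inE => /andP[].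
  right; exists (e v w), [set v], [set w]; split.
  - by rewrite {1}SE Ew.
  - by rewrite disjoints1 inE eq_sym.
  - by apply/set0Pn; exists v; rewrite inE.
  - by apply/set0Pn; exists w; rewrite inE.
  - by move=> x y; rewrite !inE => /eqP -> /eqP ->.
case: (IH (S :\ v)) => //; first by lia.
  move=> [c [p [q [r [s [[pS qS rS sS] H]]]]]]; left; exists c, p, q, r, s; split => //.
  by split; apply: (subsetP (subsetDl S [set v])).
move=> [c [S1 [S2 [E dS n1 n2 cross]]]].
have vS' : v \notin S :\ v by rewrite !inE eqxx.
have [vS1 vS2] : v \notin S1 /\ v \notin S2.
  by move: vS'; rewrite E inE negb_or => /andP[].
have disj x : x \in S1 -> x \in S2 -> False.
  by move=> x1 x2; move/pred0P/(_ x): dS; rewrite /= x1 x2.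
have neg (a : bool) : a <> ~~ c -> a = c by case: a; case: (c).
(* A vertex [v] opposite to [c] everywhere splits off alone; one that sees a whole side with [c]
   moves to the other side; the mixed case is [P4_or_split_mixed]. *)
have [allc|/existsNP[w /not_implyP[wS /neg ew]]] :=
    EM (forall x, x \in S :\ v -> e v x = ~~ c).
  right; exists (~~ c), [set v], (S :\ v); split => //.
  - by rewrite disjoints1.
  - by apply/set0Pn; exists v; rewrite inE.
  - by rewrite -card_gt0; lia.
  - by move=> x y; rewrite inE => /eqP ->; apply: allc.
have cross' : forall x y, x \in S2 -> y \in S1 -> e x y = c.
  by move=> x y x2 y1; rewrite e_sym; apply: cross.
have add1 A B : S = v |: (A :|: B) -> v \notin A -> [disjoint A & B] ->
    A != set0 -> (forall x y, x \in A -> y \in B -> e x y = c) ->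
    (forall x, x \in A -> e v x = c) -> splits S.
  move=> {}SE vA dAB nA crossAB H; exists c, A, (v |: B); split => //.
  - by rewrite SE setUCA.
  - rewrite -setI_eq0 setIUr setU_eq0 !setI_eq0 dAB andbT disjoint_sym.
    by rewrite disjoints1.
  - by apply/set0Pn; exists v; rewrite !inE eqxx.
  - by move=> x y xA /setU1P[->|yB]; [rewrite e_sym; apply: H|apply: crossAB].
have SE1 : S = v |: (S1 :|: S2) by rewrite -E setD1K.
have SE2 : S = v |: (S2 :|: S1) by rewrite [S2 :|: S1]setUC -E setD1K.
have dS' : [disjoint S2 & S1] by rewrite disjoint_sym.
have neg' (a : bool) : a <> c -> a = ~~ c by case: a; case: (c).
have [all1|/existsNP[y1 /not_implyP[y1S /neg' ey1]]] :=
    EM (forall x, x \in S1 -> e v x = c).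
  by right; apply: (add1 S1 S2).
have [all2|/existsNP[y2 /not_implyP[y2S /neg' ey2]]] :=
    EM (forall x, x \in S2 -> e v x = c).
  by right; apply: (add1 S2 S1).
move: wS; rewrite E inE => /orP[wS|wS].
  by rewrite SE1; apply: (P4_or_split_mixed (w := w) (y2 := y2) (c := c)).
by rewrite SE2; apply: (P4_or_split_mixed (w := w) (y2 := y1) (c := c)).
Qed.

(** Each side of a split is a module, and as [S] has at least three vertices one side is
    nontrivial. *)
Lemma prime_has_P4 S : 2 < #|S| -> prime_set S -> has_P4 S.
Proof.
move=> cS pS; case: (@P4_or_split S) => [|//|]; first by lia.
move=> [c [S1 [S2 [E dS n1 n2 cross]]]].
have cU : #|S| = #|S1| + #|S2| by rewrite E cardsU (eqP (_ : S1 :&: S2 == set0)) ?setI_eq0 // cards0 subn0.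
have big A B : S = A :|: B -> [disjoint A & B] -> B != set0 ->
   (forall x y, x \in A -> y \in B -> e x y = c) -> 1 < #|A| -> has_P4 S.
  move=> {}E {}dS nB H cA; have EA : A = S.
    apply: prime_module_eq => //; split; first by rewrite E subsetUl.
    move=> x y z xA yA; rewrite E inE => /orP[->//|zB _].
    by rewrite ![e z _]e_sym !H.
  have [b bB] := set0Pn _ nB; move/pred0P/(_ b): dS.
  by rewrite /= bB andbT EA E inE bB orbT.
have [c1|c1] := ltnP 1 #|S1|; first exact: (big S1 S2).
apply: (big S2 S1); rewrite 1?setUC 1?disjoint_sym //; last by lia.
by move=> x y x2 y1; rewrite e_sym; apply: cross.
Qed.
End Modules.

(** * Building labelled graphs *)

Section Building.
Variables (T : finType) (k : nat).
Implicit Types (e : rel T) (S : {set T}) (l : T -> 'I_k).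

(** The constructed graph is carried into the fixed type [T] by [h], so that vertex set, adjacency
    and labels vary independently without subtypes; [e] and [l] matter only on [S]. *)
Definition built e S l : Prop :=
  exists (H : lgraph k) (h : H -> T),
    [/\ constructible H, injective h, forall x, (x \in S) = (x \in codom h),
        forall x, lab x = l (h x) & forall x y, adj x y = e (h x) (h y)].

Lemma built_ext e1 e2 S l1 l2 :
  {in S, l1 =1 l2} -> {in S &, e1 =2 e2} -> built e1 S l1 -> built e2 S l2.
Proof.
move=> El Ee [H [h [cH injh codh labh adjh]]]; exists H, h.
have hS x : h x \in S by rewrite codh codom_f.
by split=> // [x|x y]; rewrite ?labh ?adjh ?El ?Ee.
Qed.

Lemma built_vertex e l x : e x x = false -> built e [set x] l.
Proof.
move=> exx; exists (lg_vertex (l x)), (fun=> x); split => //.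
- exact: constructible_vertex.
- by move=> [] [].
- move=> y; rewrite inE; apply/eqP/codomP => [->|[_ ->] //].
  by exists tt.
Qed.

Lemma built_union e S1 S2 l :
  [disjoint S1 & S2] ->
  (forall x y, x \in S1 -> y \in S2 -> e x y = false /\ e y x = false) ->
  built e S1 l -> built e S2 l -> built e (S1 :|: S2) l.
Proof.
move=> dS cross [H1 [h1 [c1 i1 s1 l1 a1]]] [H2 [h2 [c2 i2 s2 l2 a2]]].
have h1S x : h1 x \in S1 by rewrite s1 codom_f.
have h2S x : h2 x \in S2 by rewrite s2 codom_f.
have ne a b : h1 a <> h2 b.
  by move=> E; move/pred0P/(_ (h1 a)): dS; rewrite /= h1S E h2S.
exists (lg_union H1 H2), (fun u => match u with inl x => h1 x | inr y => h2 y end).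
split.
- exact: constructible_union.
- move=> [a|a] [b|b] => [/i1 -> //|/ne //|E|/i2 -> //].
  by case: (ne b a).
- move=> x; rewrite inE s1 s2; apply/orP/codomP.
    by case=> /codomP[a ->]; [exists (inl a)|exists (inr a)].
  by case=> -[a ->|a ->]; [left|right]; rewrite codom_f.
- by case=> a /=; rewrite ?l1 ?l2.
- move=> [a|a] [b|b] /=; rewrite ?a1 ?a2 //.
    by case: (cross (h1 a) (h2 b)).
  by case: (cross (h1 b) (h2 a)).
Qed.

Lemma built_join e S l i j : i != j -> built e S l ->
  built (fun x y => [|| e x y, (l x == i) && (l y == j) | (l x == j) && (l y == i)]) S l.
Proof.
move=> ij [H [h [cH injh codh labh adjh]]]; exists (lg_join ij H), h.
split=> //; first exact: constructible_join.
by move=> x y; rewrite -!labh -adjh.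
Qed.

Lemma built_relabel e S l i j : built e S l ->
  built e S (fun x => if l x == i then j else l x).
Proof.
move=> [H [h [cH injh codh labh adjh]]]; exists (lg_relabel i j H), h.
split=> //; first exact: constructible_relabel.
by move=> x; rewrite -labh.
Qed.

Lemma built_const e S l i : built e S l -> built e S (fun=> i).
Proof.
move=> B; suff H (L : seq 'I_k) : built e S (fun x => if l x \in L then i else l x).
  by apply: built_ext (H (enum 'I_k)) => // x _; rewrite mem_enum.
elim: L => [|j L IH]; first exact: B.
apply: built_ext (built_relabel j i IH) => // x _; rewrite in_cons.
case: (l x \in L); last by rewrite orbF.
by rewrite orbT; case: ifP.
Qed.

(** One step of a linear construction: a vertex with a label of its own enters, and the labels
    already present decide its neighbours. *)
Lemma built_add e S l v new (f : 'I_k -> bool) :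
  symmetric e -> e v v = false -> v \notin S ->
  (forall x, x \in S -> l x != new) -> (forall x, x \in S -> e v x = f (l x)) ->
  built e S l -> built e (v |: S) (fun x => if x == v then new else l x).
Proof.
move=> e_sym evv vS lnew ef B.
have Sv x : x \in S -> (x == v) = false by move=> xS; apply: contraNF vS => /eqP <-.
set l' := fun x => _.
(* The stage at which [v] has been joined to the labels in [L] only. [new] is kept out of [L], since
   a label cannot be joined to itself. *)
pose eL (L : seq 'I_k) x y := if x == v then (y != v) && (l y \in L)
  else if y == v then l x \in L else e x y.
suff H (L : seq 'I_k) : new \notin L -> built (eL L) (v |: S) l'.
  apply: built_ext (H [seq j <- enum 'I_k | f j && (j != new)] _) => //; last first.
    by rewrite mem_filter eqxx andbF.
  have memL j : (j \in [seq j <- enum 'I_k | f j && (j != new)]) = f j && (j != new).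
    by rewrite mem_filter mem_enum andbT.
  move=> x y; rewrite /eL !memL.
  case/setU1P => [->|xS]; case/setU1P => [->|yS]; rewrite ?eqxx ?Sv //= ?andbT.
  - by rewrite ef // lnew ?andbT.
  - by rewrite e_sym ef // lnew ?andbT.
elim: L => [_|j L IH]; last first.
  rewrite in_cons negb_or => /andP[nj nL].
  apply: built_ext (built_join nj (IH nL)) => // x y; rewrite /eL /l' !in_cons.
  case/setU1P => [->|xS]; case/setU1P => [->|yS]; rewrite ?eqxx ?Sv //=.
  - by rewrite (negPf nj) ?andbF.
  - by rewrite [new == j]eq_sym (negPf (lnew _ yS)) andbF orbF orbC.
  - by rewrite (negPf nj) (negPf (lnew _ xS)) !andbT orbC.
  - by rewrite !(negPf (lnew _ _)) ?andbF ?orbF.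
apply: built_union.
- by rewrite disjoints1.
- by move=> x y; rewrite inE => /eqP -> yS; rewrite /eL eqxx Sv.
- by apply: built_vertex; rewrite /eL eqxx.
- by apply: built_ext B => [x xS|x y xS yS]; rewrite /l' /eL ?Sv.
Qed.

Lemma constructible_inhabited (H : lgraph k) : constructible H -> inhabited H.
Proof. by elim=> {H} // G H _ [x] _ _; exists; exact: inl x. Qed.

(* Lexicographic substitution in all the vertices of H at once: this form passes
   through the induction over the construction of H. *)
Lemma built_subst (H : lgraph k) : constructible H ->
  forall S (r : T -> H) e,
    (forall x, exists l, built e (S :&: r @^-1: [set x]) l) ->
    (forall s t, s \in S -> t \in S -> r s != r t -> e s t = adj (r s) (r t)) ->
  built e S (fun s => lab (r s)).
Proof.
elim=> {H} [i|G H cG IG cH IH|i j ij G cG IG|i j G cG IG] S r e fib quo.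
(* All of [S] is one fibre, whose labels can be merged into [i]. *)
- have [l] := fib tt; have -> : S :&: r @^-1: [set tt] = S.
    by apply/setP => x; rewrite !inE; case: (r x); rewrite andbT.
  by move=> B; apply: built_ext (built_const i B) => // x y _ _.
(* Constructible graphs are nonempty, which supplies the values of [r1] and [r2] off their own
   parts. *)
- have [g0] := constructible_inhabited cG; have [h0] := constructible_inhabited cH.
  pose S1 := [set s in S | if r s is inl _ then true else false].
  pose r1 s := if r s is inl a then a else g0.
  pose r2 s := if r s is inr a then a else h0.
  have S1E s : s \in S :\: S1 -> exists b, r s = inr b.
    rewrite !inE negb_and => /andP[nr sS]; move: nr; rewrite sS /=.
    by case: (r s) => // b _; exists b.
  have S2E s : s \in S1 -> exists a, r s = inl a.
    by rewrite !inE => /andP[sS]; case: (r s) => // a _; exists a.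
  have in1 s : s \in S1 -> s \in S by rewrite inE => /andP[].
  have in2 s : s \in S :\: S1 -> s \in S by rewrite inE => /andP[].
  have -> : S = S1 :|: (S :\: S1).
    by apply/setP => s; rewrite !inE; case: (s \in S); case: (r s).
  apply: built_union.
  + by rewrite -setI_eq0; apply/eqP/setP => s; rewrite !inE; case: (s \in S); case: (r s).
  + move=> x y xS yS; have [a Ea] := S2E _ xS; have [b Eb] := S1E _ yS.
    have inx := in1 _ xS; have iny := in2 _ yS.
    by split; rewrite quo ?Ea ?Eb.
  + apply: (built_ext (l1 := fun s => lab (r1 s)) (e1 := e)) => // [s /S2E[a Ea]|]; first by rewrite /r1 Ea.
    apply: IG => [x|s t sS tS].
      have [l B] := fib (inl x); exists l.
      suff -> : S1 :&: r1 @^-1: [set x] = S :&: r @^-1: [set inl x] by [].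
      apply/setP => s; rewrite !inE /r1; case: (r s) => a /=; first by rewrite andbT.
      by rewrite !andbF.
    have [a Ea] := S2E _ sS; have [b Eb] := S2E _ tS.
    have ne : r s != r t -> e s t = adj (r s) (r t) by apply: quo; apply: in1.
    rewrite /r1 Ea Eb => ab; rewrite ne Ea Eb //.
  + apply: (built_ext (l1 := fun s => lab (r2 s)) (e1 := e)) => // [s /S1E[a Ea]|]; first by rewrite /r2 Ea.
    apply: IH => [x|s t sS tS].
      have [l B] := fib (inr x); exists l.
      suff -> : (S :\: S1) :&: r2 @^-1: [set x] = S :&: r @^-1: [set inr x] by [].
      apply/setP => s; rewrite !inE /r2; case: (r s) => a /=; last by rewrite andbF.
      by rewrite andbT andNb !andbF.
    have [a Ea] := S1E _ sS; have [b Eb] := S1E _ tS.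
    have ne : r s != r t -> e s t = adj (r s) (r t) by apply: quo; apply: in2.
    rewrite /r2 Ea Eb => ab; rewrite ne Ea Eb //.
(* [e] inside the fibres, the graph before the join between them. A fibre carries a single label, so
   the join leaves its inside unchanged. *)
- pose e0 s t := if r s == r t then e s t else @adj G (r s) (r t).
  have B : built e0 S (fun s => @lab k G (r s)).
    apply: IG => [x|s t sS tS st].
      have [l B] := fib x; exists l; apply: built_ext B => // s t.
      by rewrite !inE => /andP[_ /eqP Es] /andP[_ /eqP Et]; rewrite /e0 Es Et eqxx.
    by rewrite /e0 (negPf st).
  apply: built_ext (built_join ij B) => // s t sS tS; rewrite /e0.
  have [E|ne] := eqVneq (r s) (r t); last by rewrite quo.
  rewrite E; case: (_ =P i) => [->|]; rewrite ?(negPf ij) ?andbF ?orbF //.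
- by apply: built_ext (built_relabel i j (IG S r e fib quo)).
Qed.

(** Substitution with [M] as the fibre over its representative [m] and single vertices as the other
    fibres; the members of [M] look alike from outside. *)
Lemma built_module e S M m l1 l2 : symmetric e ->
  module e S M -> m \in M ->
  built e (m |: (S :\: M)) l1 -> built e M l2 -> exists l, built e S l.
Proof.
move=> e_sym [MS mod] mM [H [h [cH injh codh labh adjh]]] BM.
have [g0] := constructible_inhabited cH.
have inh x : x \in m |: (S :\: M) -> exists y, h y = x.
  by rewrite codh => /codomP[y ->]; exists y.
pose p x := if x \in M then m else x.
pose r x := if [pick y | h y == p x] is Some y then y else g0.
have rE x : x \in S -> h (r x) = p x.
  move=> xS; rewrite /r; case: pickP => [y /eqP //|no].
  have : p x \in m |: (S :\: M).
    by rewrite /p; case: ifP => xM; rewrite !inE ?eqxx // xM xS orbT.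
  by move=> /inh[y Ey]; move: (no y); rewrite Ey eqxx.
have pS x : x \in S -> p x \in S.
  by rewrite /p; case: ifP => // _ _; apply: (subsetP MS).
exists (fun s => lab (r s)); apply: built_subst => // [x|s t sS tS st].
  have [xm|xm] := eqVneq (h x) m.
    exists l2; suff -> : S :&: r @^-1: [set x] = M by [].
    apply/setP => s; rewrite !inE; apply/andP/idP => [[sS /eqP Es]|sM].
      move: (rE s sS); rewrite Es xm /p; case: ifP => // sM ms.
      by rewrite ms sM in mM.
    have sS := subsetP MS _ sM; split => //; apply/eqP/injh.
    by rewrite rE // /p sM xm.
  have hxS : h x \in S :\: M.
    have : h x \in m |: (S :\: M) by rewrite codh codom_f.
    by rewrite !inE (negPf xm).
  have [hxM hxS'] : h x \notin M /\ h x \in S by move: hxS; rewrite inE => /andP[].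
  exists l1; suff -> : S :&: r @^-1: [set x] = [set h x].
    by apply: built_vertex; rewrite -adjh adj_irr.
  apply/setP => s; rewrite !inE; apply/andP/eqP => [[sS /eqP Es]|->].
    move: (rE s sS); rewrite Es /p; case: ifP => // sM E.
    by rewrite E eqxx in xm.
  by split => //; apply/eqP/injh; rewrite rE // /p (negPf hxM).
rewrite adjh !rE //; move: st; rewrite -(inj_eq injh) !rE // /p.
case: ifP => sM; case: ifP => tM; rewrite ?eqxx // => _.
- by rewrite ![e _ t]e_sym; apply: mod; rewrite ?tM.
- by apply: mod; rewrite ?sM.
Qed.
End Building.

Lemma built_clique_width (G : sgraph) k (l : G -> 'I_k) :
  built (@adj G) [set: G] l -> clique_width G <= k.
Proof.
move=> [H [h [cH injh codh labh adjh]]].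
rewrite /clique_width; case: ex_minnP => m _; apply; apply/asboolP; right.
exists H => //.
have inh x : exists y, h y == x.
  by have := codh x; rewrite inE => /esym/codomP[y ->]; exists y.
pose g x := xchoose (inh x).
have gK x : h (g x) = x by apply/eqP/(xchooseP (inh x)).
exists g; first by exists h => x; [exact: gK|apply: injh; rewrite gK].
by move=> x y; rewrite adjh !gK.
Qed.

(** * Linear constructions with sixteen labels *)

Section Linear.
Variables (T : finType) (e : rel T).
Hypotheses (e_sym : symmetric e) (e_irr : irreflexive e).
Local Notation "''L' n" := (@Ordinal 16 n isT) (at level 8, n at level 2).

Lemma set_rcons (s : seq T) v : [set x in rcons s v] = v |: [set x in s].
Proof. by apply/setP => x; rewrite !inE mem_rcons in_cons. Qed.

(** Each vertex keeps a label of its own, its index in [s], so its adjacency to later vertices can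
    be chosen freely. *)
Lemma built_small (s : seq T) : uniq s -> 0 < size s <= 16 ->
  exists l : T -> 'I_16, built e [set x in s] l.
Proof.
move=> us; suff H : 0 < size s <= 16 -> exists l : T -> 'I_16,
    built e [set x in s] l /\ forall x, x \in s -> l x = inord (index x s).
  by move=> /H[l [B _]]; exists l.
elim/last_ind: s us => // s v IH.
rewrite rcons_uniq size_rcons => /andP[vs us] /andP[_ ss].
have [s0|s1] := posnP (size s).
  move/size0nil: s0 => ->; exists (fun=> inord 0); split.
    rewrite (_ : [set x in _] = [set v]); first exact: built_vertex.
    by apply/setP => x; rewrite !inE.
  by move=> x; rewrite inE => /eqP -> /=; rewrite eqxx.
have [|l [B Bl]] := IH us; first by rewrite s1 ltnW.
exists (fun x => if x == v then inord (size s) else l x); split.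
  rewrite set_rcons.
  apply: (built_add (f := fun j => e v (nth v s j))) B => // [|x|x]; rewrite ?inE // => xs.
    rewrite Bl // -(inj_eq val_inj) /= !inordK //; last first.
      by apply: ltn_trans ss; rewrite index_mem.
    by rewrite neq_ltn index_mem xs.
  rewrite Bl // inordK ?nth_index //.
  by apply: ltn_trans ss; rewrite index_mem.
move=> x; rewrite mem_rcons in_cons -cats1 index_cat => /orP[/eqP ->|xs].
  by rewrite eqxx (negPf vs) /= eqxx addn0.
by rewrite xs Bl //; case: eqP => // E; rewrite -E xs in vs.
Qed.

Definition shape (phi : nat -> nat -> bool) (c : bool) (s : seq T) :=
  forall x0 i j, i < j -> j < size s -> e (nth x0 s j) (nth x0 s i) = c (+) phi i j.

Lemma shape_rcons phi c s v : shape phi c (rcons s v) -> shape phi c s.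
Proof.
move=> H x0 i j ij js; have := H x0 i j ij; rewrite size_rcons !nth_rcons.
by rewrite js (ltn_trans ij js); apply; apply: ltnW.
Qed.

Lemma shape_last phi c s v i : shape phi c (rcons s v) -> i < size s ->
  e v (nth v s i) = c (+) phi i (size s).
Proof.
move=> H is_; have := H v i (size s) is_; rewrite size_rcons ltnS leqnn => /(_ isT).
by rewrite !nth_rcons ltnn eqxx is_.
Qed.

(* Both relations are meant for i < j. In a half graph the even positions form
   one colour class; in a spider 0 is the centre and 2i+1, 2i+2 form a leg. *)
Definition half_rel i j := ~~ odd i && odd j.
Definition spider_rel i j := (i == 0) && odd j || (j == i.+1) && odd i.

(** An entering vertex depends only on the parities of the earlier positions, so two labels suffice,
    with a third for the entering vertex itself. *)
Lemma built_half c s : uniq s -> 0 < size s -> shape half_rel c s ->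
  exists l : T -> 'I_16, built e [set x in s] l.
Proof.
move=> us s0 sh; suff [l [B _]] : exists l : T -> 'I_16,
    built e [set x in s] l /\
    forall x0 i, i < size s -> l (nth x0 s i) = if odd i then 'L 1 else 'L 0.
  by exists l.
elim/last_ind: s us s0 sh => // s v IH.
rewrite rcons_uniq size_rcons => /andP[vs us] _ sh.
have [s0|s1] := posnP (size s).
  move/size0nil: s0 => ->; exists (fun=> 'L 0); split; last by move=> x0 [].
  rewrite (_ : [set x in _] = [set v]); first exact: built_vertex.
  by apply/setP => x; rewrite !inE.
have [l [B Bl]] := IH us s1 (shape_rcons sh).
have Bx x : x \in s -> l x = if odd (index x s) then 'L 1 else 'L 0.
  by move=> xs; rewrite -{1}(nth_index x xs) Bl // index_mem.
have B' : built e (v |: [set x in s]) (fun x => if x == v then 'L 2 else l x).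
  apply: (built_add (f := fun j => c (+) ((j == 'L 0) && odd (size s)))) B => //.
  - by rewrite inE.
  - by move=> x; rewrite inE => /Bx ->; case: odd.
  - move=> x; rewrite inE => xs; rewrite Bx // -{1}(nth_index v xs).
    by rewrite (shape_last sh) ?index_mem // /half_rel; case: (odd (index x s)).
exists (fun x => if (if x == v then 'L 2 else l x) == 'L 2
                 then (if odd (size s) then 'L 1 else 'L 0)
                 else (if x == v then 'L 2 else l x)).
split; first by rewrite set_rcons; apply: built_relabel.
move=> x0 i; rewrite ltnS leq_eqVlt nth_rcons => /orP[/eqP ->|is_].
  by rewrite ltnn eqxx eqxx.
rewrite is_; have -> : (nth x0 s i == v) = false.
  by apply: contraNF vs => /eqP <-; rewrite mem_nth.
by rewrite Bl //; case: (odd i).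
Qed.

(** Label 0 is the centre, 1 the last vertex, the only one a leg may still continue from, 2 the
    finished vertices and 3 the entering one. The final labels belong to the statement because
    [spider_built] may attach one more vertex to the centre. *)
Lemma built_spider c s : uniq s -> 0 < size s -> shape spider_rel c s ->
  exists l : T -> 'I_16, built e [set x in s] l /\
    forall x0 i, i < size s -> l (nth x0 s i) =
      if i == 0 then 'L 0 else if i.+1 == size s then 'L 1 else 'L 2.
Proof.
elim/last_ind: s => // s v IH.
rewrite rcons_uniq size_rcons => /andP[vs us] _ sh.
have [s0|s1] := posnP (size s).
  move/size0nil: s0 => ->; exists (fun=> 'L 0); split; last by move=> x0 [].
  rewrite (_ : [set x in _] = [set v]); first exact: built_vertex.
  by apply/setP => x; rewrite !inE.
have [l [B Bl]] := IH us s1 (shape_rcons sh).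
have Bx x : x \in s -> l x = if index x s == 0 then 'L 0
    else if (index x s).+1 == size s then 'L 1 else 'L 2.
  by move=> xs; rewrite -{1}(nth_index x xs) Bl // index_mem.
pose l1 x := if x == v then 'L 3 else l x.
have B1 : built e (v |: [set x in s]) l1.
  apply: (built_add (f := fun j => c (+)
    ((j == 'L 0) && odd (size s) || (j == 'L 1) && ~~ odd (size s)))) B => //.
  - by rewrite inE.
  - by move=> x; rewrite inE => /Bx ->; do 2?case: ifP.
  - move=> x; rewrite inE => xs; rewrite Bx // -{1}(nth_index v xs).
    rewrite (shape_last sh) ?index_mem // /spider_rel [_.+1 == size s]eq_sym.
    have [i0|i0] := eqVneq (index x s) 0; first by rewrite i0 andbF !orbF.
    have [E|ne] := eqVneq (size s) (index x s).+1; last by rewrite orbF.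
    by rewrite [in RHS]E /= negbK.
(* The former last vertex must be marked finished before the entering one takes over label 1. *)
have B2 := built_relabel ('L 3) ('L 1) (built_relabel ('L 1) ('L 2) B1).
eexists; split; first by rewrite set_rcons; exact: B2.
move=> x0 i; rewrite ltnS leq_eqVlt nth_rcons => /orP[/eqP ->|is_].
  by rewrite ltnn !eqxx /l1 eqxx /= eqn0Ngt s1 /=.
rewrite is_ /l1; have -> : (nth x0 s i == v) = false.
  by apply: contraNF vs => /eqP <-; rewrite mem_nth.
rewrite Bl //; case: (i == 0) => //; rewrite eqSS (ltn_eqF is_).
by case: (i.+1 == size s).
Qed.
End Linear.

(** * Adjacency matrices *)

(* A graph on {0, ..., n-1} is encoded by the lower triangle of its adjacency
   matrix: row j lists the adjacencies of j to 0, ..., j-1. *)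
Definition mkm (phi : nat -> nat -> bool) n : seq (seq bool) :=
  mkseq (fun j => mkseq (fun i => phi i j) j) n.

Definition mget (m : seq (seq bool)) i j := nth false (nth [::] m (maxn i j)) (minn i j).

Definition submat m (p : seq nat) := mkm (fun i j => mget m (nth 0 p i) (nth 0 p j)) (size p).

Fixpoint bits n : seq (seq bool) :=
  if n is n'.+1 then flatten [seq [:: false :: b; true :: b] | b <- bits n'] else [:: [::]].

Fixpoint combs k (l : seq nat) : seq (seq nat) :=
  if k is k'.+1 then
    if l is x :: l' then map (cons x) (combs k' l') ++ combs k l' else [::]
  else [:: [::]].

(** The permutations run over all vertices of [m], so this is isomorphism with a graph of the same
    size. *)
Definition contains m t := has (fun p => submat m p == t) (permutations (iota 0 (size m))).

Definition mmodule m b :=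
  all (fun k => nth false b k ||
         constant [seq mget m k i | i <- mask b (iota 0 (size m))]) (iota 0 (size m)).

(** Candidate modules are bit masks; a short list [L] gives a cheap necessary condition for
    primality. *)
Definition mprime_for L m :=
  all (fun b => [|| count id b <= 1, count id b == size m | ~~ mmodule m b]) L.

Definition mprime m := mprime_for (bits (size m)) m.

Lemma mem_bits n b : (b \in bits n) = (size b == n).
Proof.
elim: n b => [|n IH] b; first by case: b.
apply/flattenP/idP => [[t /mapP[c cn ->]]|].
  by rewrite !inE => /orP[] /eqP -> /=; rewrite eqSS -IH.
case: b => // a b; rewrite /= eqSS -IH => bn.
exists [:: false :: b; true :: b]; first exact: map_f.
by rewrite !inE; case: a; rewrite eqxx ?orbT.
Qed.

Lemma combsP k l p : p \in combs k l -> subseq p l /\ size p = k.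
Proof.
elim: l k p => [|x l IH] [|k] p //=; rewrite ?inE.
- by move=> /eqP ->.
- by move=> /eqP ->.
rewrite mem_cat => /orP[/mapP[q /IH[sq qk] ->]|/IH[sp pk]].
  by rewrite /= eqxx qk.
by split => //; apply: subseq_trans sp (subseq_cons _ _).
Qed.

Lemma eq_mkm phi psi n :
  (forall i j, i < j -> j < n -> phi i j = psi i j) <-> mkm phi n = mkm psi n.
Proof.
split=> [H|H i j ij jn].
  apply: (@eq_from_nth _ [::]); rewrite !size_mkseq // => j jn.
  rewrite !nth_mkseq //; apply: (@eq_from_nth _ false); rewrite !size_mkseq // => i ij.
  by rewrite !nth_mkseq ?H.
have /(congr1 (fun m => nth false (nth [::] m j) i)) := H.
by rewrite !nth_mkseq.
Qed.

Lemma mget_mkm phi n i j : i != j -> i < n -> j < n ->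
  mget (mkm phi n) i j = phi (minn i j) (maxn i j).
Proof.
move=> ij i_n jn; rewrite /mget !nth_mkseq // ?gtn_max ?i_n //.
by rewrite gtn_min !leq_max !ltnn /= orbF; case: ltngtP ij.
Qed.

Lemma constant_mapP (A B : eqType) (f : A -> B) (l : seq A) :
  reflect (forall x y, x \in l -> y \in l -> f x = f y) (constant (map f l)).
Proof.
case: l => [|a l] /=; first by apply: ReflectT.
rewrite all_map; apply: (iffP allP) => [H x y|H x xl].
  have Ha z : z \in a :: l -> f z = f a.
    by rewrite in_cons => /orP[/eqP -> //|/H /eqP].
  by move=> /Ha -> /Ha ->.
by apply/eqP/H; rewrite in_cons ?eqxx ?xl ?orbT.
Qed.

Section Matrices.
Variables (T : finType) (x0 : T).
Implicit Types (e : rel T) (s : seq T).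

Definition mat e s := mkm (fun i j => e (nth x0 s j) (nth x0 s i)) (size s).

Lemma size_mat e s : size (mat e s) = size s.
Proof. by rewrite size_mkseq. Qed.

Lemma mat_rcons e s v : mat e (rcons s v) = rcons (mat e s) [seq e v x | x <- s].
Proof.
rewrite /mat size_rcons /mkm mkseqS; congr (rcons _ _).
  apply: (@eq_from_nth _ [::]); rewrite !size_mkseq // => j js.
  rewrite !nth_mkseq //; apply: (@eq_from_nth _ false); rewrite !size_mkseq // => i ij.
  by rewrite !nth_mkseq // !nth_rcons js (ltn_trans ij js).
apply: (@eq_from_nth _ false); rewrite !size_mkseq ?size_map // => i ij.
by rewrite nth_mkseq // !nth_rcons ltnn eqxx ij (nth_map x0).
Qed.

Lemma take_mat e s j : j <= size s -> take j (mat e s) = mat e (take j s).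
Proof.
move=> js; apply: (@eq_from_nth _ [::]).
  by rewrite size_takel ?size_mat // size_takel.
rewrite size_takel ?size_mat // => i ij; rewrite nth_take //.
have ijs := leq_trans ij js; rewrite !nth_mkseq // ?size_takel //.
apply: (@eq_from_nth _ false); rewrite !size_mkseq // => h hi.
by rewrite !nth_mkseq // !nth_take // (ltn_trans hi ij).
Qed.

Lemma mget_mat e s i j : symmetric e -> i != j -> i < size s -> j < size s ->
  mget (mat e s) i j = e (nth x0 s i) (nth x0 s j).
Proof.
by move=> e_sym ij is_ js; rewrite mget_mkm //; case: ltngtP ij.
Qed.

Lemma submat_mat e s p : symmetric e -> uniq p -> all (fun i => i < size s) p ->
  submat (mat e s) p = mat e [seq nth x0 s i | i <- p].
Proof.
move=> e_sym up ps; rewrite /submat /mat size_map; apply/eq_mkm => i j ij jp.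
have ip := ltn_trans ij jp.
rewrite mget_mat // ?(nth_uniq 0) // ?(ltn_eqF ij) //; last 2 first.
- by apply: (allP ps); apply: mem_nth.
- by apply: (allP ps); apply: mem_nth.
by rewrite e_sym !(nth_map 0).
Qed.


Lemma matP phi e s :
  (forall i j, i < j -> j < size s -> e (nth x0 s j) (nth x0 s i) = phi i j) <->
  mat e s = mkm phi (size s).
Proof. exact: eq_mkm. Qed.

Lemma mat_mkm phi e s n i j : mat e s = mkm phi n -> i < j -> j < n ->
  e (nth x0 s j) (nth x0 s i) = phi i j.
Proof.
move=> E; have sn : size s = n by rewrite -(size_mat e) E size_mkseq.
by rewrite -{}sn in E *; move/matP: E => H ij jn; apply: H.
Qed.


Lemma containsP e s t : symmetric e -> uniq s -> contains (mat e s) t ->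
  exists2 s', perm_eq s' s & mat e s' = t.
Proof.
move=> e_sym us /hasP[p]; rewrite mem_permutations size_mat => pp /eqP <-.
have up : uniq p by rewrite (perm_uniq pp) iota_uniq.
exists [seq nth x0 s i | i <- p].
  have {2}-> : s = [seq nth x0 s i | i <- iota 0 (size s)].
    by rewrite map_nth_iota0 // take_size.
  exact: perm_map.
rewrite submat_mat //; apply/allP => i.
by rewrite (perm_mem pp) mem_iota.
Qed.

Lemma mprimeP e s : symmetric e -> uniq s ->
  reflect (prime_set e [set x in s]) (mprime (mat e s)).
Proof.
move=> e_sym us; set S := [set x in s].
have cS : #|S| = size s by rewrite cardsE; apply/card_uniqP.
have vals b k : k < size s -> size b = size s -> nth false b k = false ->
   [seq mget (mat e s) k i | i <- mask b (iota 0 (size s))] =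
   [seq e (nth x0 s k) x | x <- mask b s].
  move=> ks bs bk.
  have E : s = [seq nth x0 s i | i <- iota 0 (size s)].
    by rewrite map_nth_iota0 // take_size.
  rewrite {4}E -map_mask -map_comp; apply/eq_in_map => i im /=.
  have := mem_mask im; rewrite mem_iota => /= is_.
  rewrite mget_mat //; apply: contraTneq im => <-.
  rewrite in_mask ?iota_uniq // -{2}[k](@nth_iota 0 0 (size s)) // index_uniq ?size_iota ?iota_uniq //.
  by rewrite bk andbF.
have mmE b : size b = size s ->
    mmodule (mat e s) b <-> module e S [set x in mask b s].
  move=> bs; rewrite /mmodule size_mat; split=> [/allP H|[sub H]].
    split=> [|x y z]; first by apply/subsetP => x; rewrite !inE => /mem_mask.
    rewrite !inE => xM yM zs zM; set k := index z s.
    have ks : k < size s by rewrite index_mem.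
    have bk : nth false b k = false by move: zM; rewrite in_mask // zs => /negbTE.
    have := H k; rewrite mem_iota ks bk => /(_ isT) /=.
    by rewrite vals // nth_index // => /constant_mapP; apply.
  apply/allP => k; rewrite mem_iota => /= ks.
  have [//|/negbTE bk] := boolP (nth false b k).
  rewrite vals //=; apply/constant_mapP => x y xm ym.
  apply: H; rewrite ?inE ?mem_nth //.
  by rewrite in_mask // index_uniq // bk andbF.
have cmask b : size b = size s -> #|[set x in mask b s]| = count id b.
  by move=> bs; rewrite cardsE -(size_mask bs); apply/card_uniqP; apply: mask_uniq.
apply: (iffP allP) => [H M mM|pS b].
  pose b := [seq x \in M | x <- s].
  have bs : size b = size s by rewrite size_map.
  have ME : M = [set x in mask b s].
    apply/setP => x; rewrite inE -filter_mask mem_filter.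
    have [xM|//] := boolP (x \in M); case: mM => /subsetP/(_ x xM).
    by rewrite inE => ->.
  have := H b; rewrite mem_bits size_mat bs eqxx => /(_ isT) /or3P[c1|/eqP cn|].
  - by left; rewrite ME cmask.
  - right; apply/eqP; rewrite eqEcard cS {2}ME cmask // cn leqnn andbT.
    by case: mM.
  - by case/negP; apply/mmE; rewrite // -ME.
rewrite mem_bits size_mat => /eqP bs.
case: (boolP (mmodule _ _)) => [/(mmE b bs) mb|]; last by rewrite !orbT.
case: (pS _ mb) => [|/(congr1 (fun A : {set T} => #|A|))].
  by rewrite cmask // => ->.
by rewrite cmask // cS => ->; rewrite eqxx orbT.
Qed.
End Matrices.

(** * Finite search *)

(** A five-vertex graph is ten bits. Tests on such graphs occur throughout the search, so their
    values are tabulated once in a binary tree indexed by these bits. *)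
Inductive bitree := Leaf of bool | Node of bitree & bitree.

Fixpoint tabulate n (f : seq bool -> bool) : bitree :=
  if n is n'.+1 then Node (tabulate n' (fun b => f (false :: b)))
                          (tabulate n' (fun b => f (true :: b)))
  else Leaf (f [::]).

Fixpoint lookup t b : bool :=
  match t, b with
  | Node l r, a :: b' => if a then lookup r b' else lookup l b'
  | Leaf a, _ => a
  | _, _ => false
  end.

Lemma lookup_tabulate f b : lookup (tabulate (size b) f) b = f b.
Proof. by elim: b f => //= [[] b IH] f; rewrite IH. Qed.

Definition P5_mat := mkm (fun i j => j == i.+1) 5.
Definition coP5_mat := mkm (fun i j => j != i.+1) 5.
Definition Bull_mat := mkm (fun i j => (i, j) \in [:: (0, 1); (1, 2); (2, 3); (1, 4); (2, 4)]) 5.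
Definition C5_mat := mkm (fun i j => (j == i.+1) || (i == 0) && (j == 4)) 5.

Definition bad m := [|| contains m P5_mat, contains m coP5_mat | contains m Bull_mat].

(** Row [j] of a triangular matrix has length [j], so this inverts [flatten]. *)
Definition unflat5 (b : seq bool) := reshape (iota 0 5) b.

Definition bad_table := Eval vm_compute in tabulate 10 (fun b => bad (unflat5 b)).
Definition prime_table := Eval vm_compute in tabulate 10 (fun b => mprime (unflat5 b)).

Definition fbad m := lookup bad_table (flatten m).
Definition fprime m := lookup prime_table (flatten m).

Lemma size_flatten_mkm phi : size (flatten (mkm phi 5)) = 10.
Proof. by []. Qed.

Lemma unflat5K phi : unflat5 (flatten (mkm phi 5)) = mkm phi 5.
Proof. by []. Qed.

Lemma bad_tableE : bad_table = tabulate 10 (fun b => bad (unflat5 b)).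
Proof. by vm_cast_no_check (erefl bad_table). Qed.

Lemma prime_tableE : prime_table = tabulate 10 (fun b => mprime (unflat5 b)).
Proof. by vm_cast_no_check (erefl prime_table). Qed.

Lemma fbadE phi : fbad (mkm phi 5) = bad (mkm phi 5).
Proof.
rewrite /fbad bad_tableE -{1}(size_flatten_mkm phi) lookup_tabulate.
by rewrite unflat5K.
Qed.

Lemma fprimeE phi : fprime (mkm phi 5) = mprime (mkm phi 5).
Proof.
rewrite /fprime prime_tableE -{1}(size_flatten_mkm phi) lookup_tabulate.
by rewrite unflat5K.
Qed.

(* The matrices are grown one vertex at a time, so only the subsets containing
   the last vertex are inspected. *)
Definition sparsem m :=
  let n := (size m).-1 in
  let L := [seq p <- [seq rcons q n | q <- combs 4 (iota 0 n)] | fbad (submat m p)] in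
  all (fun p => all (fun q => ~~ [&& uniq q, count [in q] p == 4 & fbad (submat m q)])
                    (L ++ [seq w :: take 4 p | w <- iota 0 n])) L.

Definition goodm m :=
  let n := (size m).-1 in
  all (fun p => ~~ fprime (submat m (rcons p n))) (combs 4 (iota 0 n)).

(* The possible modules of a prime graph on {0, ..., n-1} with two further
   vertices n and n+1, see [prime_pair_failure]. *)
Definition masks2 n : seq (seq bool) :=
  [seq mkseq (fun i => i \in M) n.+2 | M : seq nat <-
    [:: iota 0 n; iota 0 n.+1; n.+1 :: iota 0 n; [:: n; n.+1]] ++
    flatten [seq [:: [:: u; n]; [:: u; n.+1]; [:: u; n; n.+1]] | u <- iota 0 n]].

Definition mprime2 m := mprime_for (masks2 (size m - 2)) m.

(** Taking unordered pairs halves the search, as the order of the two new vertices is immaterial.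
    The diagonal is included. *)
Fixpoint unordered (A : Type) (l : seq A) : seq (A * A) :=
  if l is a :: l' then [seq (a, b) | b <- l] ++ unordered l' else [::].

Section Extensions.
Variable ck : seq (seq bool) -> bool.

(** Candidate rows of a new vertex. They can be pruned after each entry, since the first [j]
    vertices with the new one induce a subgraph, which has to pass [ck] too. *)
Fixpoint rows m j : seq (seq bool) :=
  if j is j'.+1 then
    [seq r <- flatten [seq [:: rcons r false; rcons r true] | r <- rows m j'] |
       ck (rcons (take j m) r)]
  else [:: [::]].

Definition ext2 m :=
  [seq m' <- [seq m' <- flatten [seq
     [:: rcons (rcons m r.1) (rcons r.2 false); rcons (rcons m r.1) (rcons r.2 true)]
     | r <- unordered (rows m (size m))] | ck m'] | mprime2 m'].
End Extensions.

Definition half_mat c n := mkm (fun i j => c (+) half_rel i j) n.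
Definition spider_mat c n := mkm (fun i j => c (+) spider_rel i j) n.

Definition spider7 m := contains m (spider_mat false 7) || contains m (spider_mat true 7).

Definition starts := [:: P5_mat; coP5_mat; Bull_mat; C5_mat].

(** * Soundness of the search *)

Section Soundness.
Variables (T : finType) (x0 : T) (e : rel T).
Hypothesis e_sym : symmetric e.
Local Notation mat := (mat x0).

(** Two distinct 5-sets lie in a common 6-set exactly when they share four elements. *)
Definition sparse := forall t1 t2, uniq t1 -> uniq t2 -> size t1 = 5 -> size t2 = 5 ->
  bad (mat e t1) -> bad (mat e t2) -> count [in t2] t1 != 4.

Definition good_on (S : {set T}) := forall t, uniq t -> size t = 5 -> {subset t <= S} ->
  ~ prime_set e [set x in t].

(** The test must not lose any sparse graph. A bad set that shares four vertices with [p] and avoids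
    the last vertex is [p] with that vertex replaced by some [w], whence the words [w :: take 4 p]
    in [sparsem]. *)
Lemma sparsem_mat s v : sparse -> uniq (rcons s v) -> sparsem (mat e (rcons s v)).
Proof.
move=> sp us; set w := rcons s v.
have wS : size w = (size s).+1 by rewrite size_rcons.
rewrite /sparsem size_mat wS /=; set n := size s.
have sub p : uniq p -> size p = 5 -> all (fun i => i < size w) p -> fbad (submat (mat e w) p) ->
    bad (mat e [seq nth x0 w i | i <- p]).
  move=> up p5 pw; rewrite /submat p5 fbadE -{1}p5 -/(submat _ _).
  by rewrite submat_mat.
have lastp q : q \in combs 4 (iota 0 n) ->
   [/\ uniq (rcons q n), size (rcons q n) = 5 & all (fun i => i < size w) (rcons q n)].
  move=> /combsP[sq q4]; split; rewrite ?size_rcons ?q4 //.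
    rewrite rcons_uniq (subseq_uniq sq) ?iota_uniq // andbT.
    by apply/negP => /(mem_subseq sq); rewrite mem_iota add0n ltnn andbF.
  rewrite all_rcons ?wS leqnn /=; apply/allP => i /(mem_subseq sq).
  by rewrite mem_iota add0n => /andP[_ /ltnW].
apply/allP => p; rewrite mem_filter => /andP[bp /mapP[q0 /lastp[up p5 pw] E]].
rewrite -{}E in up p5 pw.
apply/allP => q qin; apply/negP => /and3P[uq /eqP c4 bq].
have [q5 qw] : size q = 5 /\ all (fun i => i < size w) q.
  move: qin; rewrite mem_cat => /orP[|/mapP[i]].
    by rewrite mem_filter => /andP[_ /mapP[q1 /lastp[_ ? ?] ->]].
  rewrite mem_iota add0n => /andP[_ iw] ->; rewrite /= size_takel ?p5 //; split => //.
  rewrite {1}wS ltnS ltnW //=; apply/allP => j /mem_take; exact: (allP pw).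
have inj i j : i \in p -> j \in q -> nth x0 w i = nth x0 w j -> i = j.
  move=> /(allP pw) iw /(allP qw) jw /eqP; rewrite nth_uniq // => /eqP //.
have umap r : uniq r -> all (fun i => i < size w) r -> uniq [seq nth x0 w i | i <- r].
  move=> ur rw; rewrite map_inj_in_uniq // => i j /(allP rw) ir /(allP rw) jr /eqP.
  by rewrite nth_uniq // => /eqP.
have := sp _ _ (umap p up pw) (umap q uq qw).
rewrite !size_map p5 q5 => /(_ erefl erefl (sub _ up p5 pw bp) (sub _ uq q5 qw bq)).
rewrite count_map -c4 => /eqP; apply; apply: eq_in_count => i ip /=.
apply/mapP/idP => [[j jq E]|iq]; first by rewrite (inj _ _ ip jq E).
by exists i.
Qed.

Lemma goodm_mat (S : {set T}) s v : good_on S -> uniq (rcons s v) -> {subset rcons s v <= S} ->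
  goodm (mat e (rcons s v)).
Proof.
move=> gd us sS; set w := rcons s v.
have wS : size w = (size s).+1 by rewrite size_rcons.
rewrite /goodm size_mat wS /=; set n := size s.
apply/allP => q /combsP[sq q4].
have p5 : size (rcons q n) = 5 by rewrite size_rcons q4.
have up : uniq (rcons q n).
  rewrite rcons_uniq (subseq_uniq sq) ?iota_uniq // andbT.
  by apply/negP => /(mem_subseq sq); rewrite mem_iota add0n ltnn andbF.
have pw : all (fun i => i < size w) (rcons q n).
  rewrite all_rcons ?wS leqnn /=; apply/allP => i /(mem_subseq sq).
  by rewrite mem_iota add0n => /andP[_ /ltnW].
have um : uniq [seq nth x0 w i | i <- rcons q n].
  rewrite map_inj_in_uniq // => i j /(allP pw) ir /(allP pw) jr /eqP.
  by rewrite nth_uniq // => /eqP.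
rewrite /submat p5 fprimeE -{1}p5 -/(submat _ _) submat_mat //.
apply/negP => /(mprimeP x0 e_sym um); apply: gd => //; first by rewrite size_map.
move=> x /mapP[i ip ->]; apply: sS; rewrite mem_nth //; exact: (allP pw).
Qed.

Section Ext.
Variables (ck : seq (seq bool) -> bool) (S : {set T}).
Hypothesis ckP : forall s v, uniq (rcons s v) -> {subset rcons s v <= S} -> ck (mat e (rcons s v)).

Lemma mem_rows s v : uniq (rcons s v) -> {subset rcons s v <= S} ->
  [seq e v x | x <- s] \in rows ck (mat e s) (size s).
Proof.
move=> us sS; rewrite -{1}(take_size s); move: (leqnn (size s)).
elim: {1 3 4}(size s) => [_|j IH js]; first by rewrite take0 inE.
rewrite /= mem_filter; apply/andP; split.
  rewrite take_mat // -mat_rcons; apply: ckP.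
    move: us; rewrite !rcons_uniq => /andP[vs us]; rewrite take_uniq // andbT.
    by apply: contra vs => /mem_take.
  move=> x; rewrite mem_rcons in_cons => /orP[/eqP ->|/mem_take xs]; apply: sS.
    by rewrite mem_rcons in_cons eqxx.
  by rewrite mem_rcons in_cons xs orbT.
rewrite (take_nth x0) // map_rcons; apply/flattenP; eexists.
  by apply: map_f; apply: IH; apply: ltnW.
by rewrite !inE; case: (e _ _); rewrite eqxx ?orbT.
Qed.

Lemma mem_unordered (A : eqType) (l : seq A) a b :
  a \in l -> b \in l -> (a, b) \in unordered l \/ (b, a) \in unordered l.
Proof.
elim: l => // c l IH.
have head x : x \in c :: l -> (c, x) \in unordered (c :: l).
  by rewrite /= -cat_cons mem_cat => xl; rewrite (map_f (pair c) xl).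
have tail p : p \in unordered l -> p \in unordered (c :: l).
  by rewrite /= -cat_cons mem_cat => ->; rewrite orbT.
move=> al bl; move: (al) (bl); rewrite !in_cons.
case/orP => [/eqP ->|al']; first by left; apply: head.
case/orP => [/eqP ->|bl']; first by right; apply: head.
by case: (IH al' bl') => H; [left|right]; apply: tail.
Qed.

(** The two rows occur as a pair in one order or the other, hence the disjunction. *)
Lemma mem_ext2 s x y : x != y -> x \in S -> y \in S -> x \notin s -> y \notin s -> uniq s ->
  {subset s <= S} -> prime_set e (x |: (y |: [set z in s])) ->
  mat e (rcons (rcons s x) y) \in ext2 ck (mat e s) \/
  mat e (rcons (rcons s y) x) \in ext2 ck (mat e s).
Proof.
move=> xy xS yS xs ys us sS pr.
have one a : a \in S -> a \notin s -> uniq (rcons s a) /\ {subset rcons s a <= S}.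
  move=> aS as_; rewrite rcons_uniq as_; split => // z.
  by rewrite mem_rcons in_cons => /orP[/eqP ->|/sS].
have [ux sx] := one x xS xs; have [uy sy] := one y yS ys.
have main a b : a != b -> a \in S -> b \in S -> a \notin s -> b \notin s ->
    a |: (b |: [set z in s]) = x |: (y |: [set z in s]) ->
    ([seq e a z | z <- s], [seq e b z | z <- s]) \in unordered (rows ck (mat e s) (size s)) ->
    mat e (rcons (rcons s a) b) \in ext2 ck (mat e s).
  move=> ab aS bS as_ bs EP H.
  have uab : uniq (rcons (rcons s a) b).
    by rewrite !rcons_uniq us mem_rcons in_cons negb_or eq_sym ab as_ bs.
  have sab : {subset rcons (rcons s a) b <= S}.
    by move=> z; rewrite !(mem_rcons, in_cons) => /or3P[/eqP ->|/eqP ->|/sS].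
  rewrite /ext2 size_mat !mem_filter; apply/and3P; split.
  - have : mprime (mat e (rcons (rcons s a) b)).
      apply/mprimeP => //; rewrite -EP in pr.
      suff -> : [set z in rcons (rcons s a) b] = a |: (b |: [set z in s]) by [].
      by apply/setP => z; rewrite !inE !(mem_rcons, in_cons) orbCA.
    (* Primality tested on all masks implies the test on the short list [masks2]. *)
    rewrite /mprime /mprime2 => /allP pm; apply/allP => m mm; apply: pm.
    rewrite mem_bits size_mat !size_rcons; move: mm.
    rewrite size_mat !size_rcons subn2 /= /masks2 => /mapP[M _ ->].
    by rewrite size_mkseq.
  - exact: ckP.
  - apply/flattenP; eexists; first exact: map_f H.
    rewrite mat_rcons mat_rcons map_rcons /= !inE.
    by case: (e b a); rewrite eqxx ?orbT.
case: (mem_unordered (mem_rows ux sx) (mem_rows uy sy)) => H; [left|right].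
  exact: main H.
by apply: main H => //; rewrite 1?eq_sym // setUCA.
Qed.
End Ext.
End Soundness.

(** * Outcomes of the finite search *)

Lemma bad_compl : all (fun b => lookup bad_table b == lookup bad_table (map negb b)) (bits 10).
Proof. by vm_cast_no_check (erefl true). Qed.

Lemma prime5_contains_start :
  all (fun b => lookup prime_table b ==> has (contains (unflat5 b)) starts) (bits 10).
Proof. by vm_cast_no_check (erefl true). Qed.

(** Sizes 5, 7, 9: apart from the spiders, nothing reaches 11, because [ext2] lists every sparse
    prime extension up to the order of the new vertices. *)
Lemma starts_growth :
  all (fun m7 => spider7 m7 || all (fun m9 => nilp (ext2 sparsem m9)) (ext2 sparsem m7))
      (flatten (map (ext2 sparsem) starts)).
Proof. by vm_cast_no_check (erefl true). Qed.

Lemma P4_growth :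
  all (fun c => all (fun m => contains m (half_mat false 6) || contains m (half_mat true 6))
                    (ext2 goodm (half_mat c 4))) [:: false; true].
Proof. by vm_cast_no_check (erefl true). Qed.

Definition half_sym i k := if i < k then half_rel i k else half_rel k i.

(** The row of a twin of vertex [k] in the half graph on six vertices, with [t] its adjacency to [k]
    itself. *)
Definition twin_word k t := mkseq (fun i => if i == k then t else half_sym i k) 6.

Definition twin_words := [seq twin_word k t | k <- iota 0 6, t <- [:: false; true]].

Definition half_words := nseq 6 false :: nseq 6 true :: twin_words.

(** Unless a new prime 5-set appears, a seventh vertex is uniform or a twin, so alone it cannot
    extend the half graph to a prime set. *)
Lemma half6_words :
  all (fun r => goodm (rcons (half_mat false 6) r) ==> (r \in half_words)) (bits 6).
Proof. by vm_cast_no_check (erefl true). Qed.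

(** The last entry negates what [l] sees at [k], as primality demands of a twin of [l] at a twin of
    [k]. The originals are then consecutive, and the pair fits between them. *)
Lemma half6_twin_twin :
  all (fun k => all (fun l => all (fun t => all (fun u =>
    [&& k < l & goodm (rcons (rcons (half_mat false 6) (twin_word k t))
                        (rcons (twin_word l u) (~~ half_sym k l)))] ==>
    [&& l == k.+1, ~~ t & ~~ u])
    [:: false; true]) [:: false; true]) (iota 0 6)) (iota 0 6).
Proof. by vm_cast_no_check (erefl true). Qed.

(** The twin must belong to an end of the half graph, where the pair can be appended. *)
Lemma half6_twin_const :
  all (fun k => all (fun t => all (fun b =>
    goodm (rcons (rcons (half_mat false 6) (twin_word k t)) (rcons (nseq 6 b) (~~ b))) ==>
    [&& ~~ b, ~~ t & (k == 0) || (k == 5)])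
    [:: false; true]) [:: false; true]) (iota 0 6).
Proof. by vm_cast_no_check (erefl true). Qed.

(** Two legs with the centre are a P5 whose middle vertex comes first; the third word sees only that
    vertex. *)
Lemma spider5_words :
  all (fun r => sparsem (rcons (spider_mat false 5) r) ==>
         (r \in [:: nseq 5 false; nseq 5 true; true :: nseq 4 false])) (bits 5).
Proof. by vm_cast_no_check (erefl true). Qed.

(** The first new vertex sees only the centre, the second sees the whole spider; sparseness forces
    them to be adjacent. *)
Lemma spider7_centre_complete :
  ~~ sparsem (rcons (rcons (spider_mat false 7) (true :: nseq 6 false))
               (rcons (nseq 7 true) false)).
Proof. by vm_cast_no_check (erefl true). Qed.

(** * Two vertices outside a prime set; complementation *)

Section PrimePair.
Variables (T : finType) (e : rel T).
Hypothesis e_sym : symmetric e.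

(** Otherwise [X], or [x] with its twin, would be a nontrivial module. *)
Lemma prime_set1_not_type (X : {set T}) x : x \notin X -> 2 < #|X| ->
  prime_set e (x |: X) -> ~ uniform_on e X x /\ forall u, ~ twin_on e X x u.
Proof.
move=> xX cX pr; split=> [U|u [uX tu]].
  have E : X = x |: X; last by move: xX; rewrite E !inE eqxx.
  apply: prime_module_eq pr _ _; last exact: ltnW.
  split=> [|a b z aX bX]; first exact: subsetUr.
  by rewrite !inE => /orP[/eqP -> _|->//]; apply: U.
have xu : x != u by apply: contraNneq xX => ->.
have E : [set x; u] = x |: X.
  apply: prime_module_eq pr _ _; last by rewrite cards2 xu.
  split=> [|a b z aM bM]; first by apply/subsetP => z; rewrite !inE => /orP[] /eqP ->; rewrite ?eqxx ?uX ?orbT.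
  rewrite !inE negb_or => /orP[->//|zX] /andP[_ zu].
  have main c : c \in [set x; u] -> e z c = e z u.
    by rewrite !inE => /orP[] /eqP -> //; rewrite e_sym tu // e_sym.
  by rewrite !main.
have := subset_leq_card (subsetUr [set x] X).
by rewrite -E cards2 xu; lia.
Qed.

(** A partial converse of [prime_pair_failure]: the clauses exclude the modules [X], {x,u}, {y,u}
    and {x,y,u}, in this order. *)
Lemma prime_pair_types (X : {set T}) x y :
  x \notin X -> y \notin X -> x != y -> 2 < #|X| -> prime_set e (x |: (y |: X)) ->
  [/\ ~ (uniform_on e X x /\ uniform_on e X y),
      forall u, twin_on e X x u -> e y x != e y u,
      forall u, twin_on e X y u -> e x y != e x u &
      forall u, twin_on e X x u -> ~ twin_on e X y u].
Proof.
move=> xX yX xy cX pr; set Z := x |: (y |: X).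
have ZE z : z \in Z -> [\/ z = x, z = y | z \in X].
  by rewrite !inE => /or3P[/eqP|/eqP|] H; [constructor 1|constructor 2|constructor 3].
have XZ z : z \in X -> z \in Z by rewrite !inE => ->; rewrite !orbT.
have xZ : x \in Z by rewrite !inE eqxx.
have yZ : y \in Z by rewrite !inE eqxx orbT.
have cZ : #|Z| = #|X|.+2.
  by rewrite !cardsU1 !inE negb_or xy xX yX.
have noM M : module e Z M -> 1 < #|M| -> #|M| < #|Z| -> False.
  by move=> mM cM; rewrite (prime_module_eq pr mM cM) ltnn.
have pairM a b u : a \in Z -> b \in Z -> (forall z, z \in Z -> [\/ z = a, z = b | z \in X]) ->
    a != b -> a \notin X -> twin_on e X a u -> e b a != e b u.
  move=> aZ bZ ZE' ab aX [uX tu]; apply/eqP => E.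
  have au : a != u by apply: contraNneq aX => ->.
  apply: (noM [set a; u]); rewrite ?cards2 ?au //; last by rewrite cZ; lia.
  split=> [|c d z cM dM /ZE' zZ]; first by apply/subsetP => z /set2P[] ->; [exact: aZ|exact: XZ].
  rewrite !inE negb_or => /andP[za zu].
  have main f : f \in [set a; u] -> e z f = e z u.
    rewrite !inE => /orP[] /eqP -> //; case: zZ za zu => [->|-> //|zX za zu].
      by rewrite eqxx.
    by rewrite e_sym tu // e_sym.
  by rewrite !main.
split.
- move=> [Ux Uy]; apply: (noM X); rewrite ?cZ //; last exact: ltnW.
  split=> [|a b z aX bX /ZE]; first by apply/subsetP => z /XZ.
  by case=> [-> _|-> _|->//]; [apply: Ux|apply: Uy].
- by move=> u; apply: pairM.
- move=> u; apply: pairM; rewrite // 1?eq_sym // => z /ZE.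
  by case; [constructor 2|constructor 1|constructor 3].
- move=> u [uX tx] [_ ty]; apply: (noM (x |: [set y; u])).
  + split=> [|a b z aM bM /ZE zZ]; first by apply/subsetP => z /setU1P[->|/set2P[] ->]; [exact: xZ|exact: yZ|exact: XZ].
    rewrite !inE !negb_or => /and3P[zx zy zu].
    have zX : z \in X by case: zZ zx zy => [->|->|//]; rewrite eqxx.
    have main f : f \in (x |: [set y; u]) -> e z f = e z u.
      by move=> /setU1P[->|/set2P[] -> //]; rewrite e_sym ?tx ?ty // e_sym.
    by rewrite !main.
  + by rewrite cardsU1 cards2 !inE negb_or xy; case: eqP xX => [->|_]; rewrite ?uX.
  + by rewrite cZ cardsU1 cards2; case: (_ \notin _); case: (_ != _); lia.
Qed.
End PrimePair.

Section ComplementFlag.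
Variables (T : finType) (x0 : T) (e : rel T) (c : bool).
Hypothesis e_sym : symmetric e.

(* For c = true this is the complement, except that the diagonal is true: modules
   and matrices do not see the diagonal. *)
Definition flag_rel : rel T := fun x y => c (+) e x y.

Lemma flag_sym : symmetric flag_rel.
Proof. by move=> x y; rewrite /flag_rel e_sym. Qed.

Lemma flag_prime_set S : prime_set flag_rel S <-> prime_set e S.
Proof.
have mE M : module flag_rel S M <-> module e S M.
  split=> -[MS H]; split=> // x y z xM yM zS zM; first exact: (addbI (H x y z xM yM zS zM)).
  by rewrite /flag_rel (H x y).
by split=> p M /mE; apply: p.
Qed.

Lemma flag_mat phi s n : mat x0 e s = mkm (fun i j => c (+) phi i j) n -> size s = n ->
  mat x0 flag_rel s = mkm phi n.
Proof.
move=> H sn; rewrite -sn in H *; apply/matP => i j ij js; move/matP: H => H.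
by rewrite /flag_rel H // addbA addbb.
Qed.

Lemma flag_good S : good_on e S -> good_on flag_rel S.
Proof. by move=> gd t ut t5 tS /flag_prime_set; apply: gd. Qed.

Lemma flag_bad t : size t = 5 -> bad (mat x0 flag_rel t) = bad (mat x0 e t).
Proof.
move=> t5; rewrite /mat t5 -!fbadE /flag_rel; case: c => //.
set phi := fun i j => e (nth x0 t j) (nth x0 t i).
have b10 : flatten (mkm phi 5) \in bits 10 by rewrite mem_bits size_flatten_mkm.
have /eqP E := allP bad_compl _ b10.
by rewrite /fbad E.
Qed.

Lemma flag_sparse : sparse x0 e -> sparse x0 flag_rel.
Proof. by move=> sp t1 t2 u1 u2 s1 s2; rewrite !flag_bad //; apply: sp. Qed.
End ComplementFlag.

(** * Vertices outside a half graph *)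

Lemma half_symE i k : half_sym i k =
  (i < k) && (~~ odd i && odd k) || (k < i) && (~~ odd k && odd i).
Proof.
rewrite /half_sym /half_rel; have [ik|ki|->] := ltngtP i k; rewrite ?orbF //.
by case: (odd k).
Qed.


Definition twin_pattern n (P : nat -> bool) k t :=
  k < n /\ forall i, i < n -> P i = if i == k then t else half_sym i k.

Definition half_pattern n P :=
  (exists b, forall i, i < n -> P i = b) \/ exists k t, twin_pattern n P k t.

Lemma half_words_pattern P : [seq P i | i <- iota 0 6] \in half_words -> half_pattern 6 P.
Proof.
have nthP i : i < 6 -> P i = nth false [seq P i | i <- iota 0 6] i.
  by move=> i6; rewrite (nth_map 0) ?size_iota // nth_iota.
rewrite 2!in_cons => /or3P[/eqP E|/eqP E|/allpairsP[[k t] [k6 _ E]]].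
- by left; exists false => i i6; rewrite nthP // E nth_nseq if_same.
- by left; exists true => i i6; rewrite nthP // E nth_nseq i6.
- right; exists k, t; split; first by move: k6; rewrite mem_iota.
  by move=> i i6; rewrite nthP // E nth_mkseq.
Qed.

(** The first four entries are those of a constant word or of a twin of 0, 2, 1, 3. The last two are
    then forced, except where a false constant or a twin of 3 can also be read as a twin in the last
    pair. *)
Lemma half_words_last :
  [/\ forall x y, [:: false; false; false; false; x; y] \in half_words -> x ==> y,
      forall x y, [:: true; true; true; true; x; y] \in half_words -> x && y,
      forall t x y, [:: t; true; false; true; x; y] \in half_words -> ~~ x && y,
      forall t x y, [:: false; false; t; true; x; y] \in half_words -> ~~ x && y &
      (forall t x y, [:: true; t; false; false; x; y] \in half_words -> ~~ x && ~~ y) /\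
      (forall t x y, [:: true; false; true; t; x; y] \in half_words ->
         if t then ~~ x && ~~ y else y ==> x)].
Proof. by split; try split; do ![case]. Qed.

(** Induction on the number of pairs. The new pair is compared with the one before it and with a
    pair that reveals the pattern so far: the pair of the twin position [k] if it is an earlier one,
    and pair 0 otherwise. *)
Lemma half_pattern_of_triples n (P : nat -> bool) :
  (forall i j k, i < j -> j < k -> k < n.+3 ->
     [:: P i.*2; P i.*2.+1; P j.*2; P j.*2.+1; P k.*2; P k.*2.+1] \in half_words) ->
  half_pattern n.+3.*2 P.
Proof.
have [w0 w1 we we2 [wo wo2]] := half_words_last.
elim: n => [|n IH] H; first exact: half_words_pattern (H 0 1 2 isT isT isT).
have IH' := IH (fun i j k ij jk kn => H i j k ij jk (leqW kn)); set N := n.+3 in H IH'.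
have lastw h : h < n.+2 -> [:: P h.*2; P h.*2.+1; P n.+2.*2; P n.+2.*2.+1; P N.*2; P N.*2.+1] \in half_words.
  by move=> hn; apply: H.
have split_i i : i < N.+1.*2 -> [\/ i < N.*2, i = N.*2 | i = N.*2.+1].
  move=> iN; case: (ltngtP i N.*2) => [?|?|?]; [constructor 1|constructor 3|constructor 2] => //.
  by move: iN; rewrite doubleS; lia.
have N2 : n.+2.*2.+1 < N.*2 by rewrite /N; lia.
have N2' : n.+2.*2 < N.*2 by rewrite /N; lia.
have twin k t : k < N.*2 -> (forall i, i < N.*2 -> P i = if i == k then t else half_sym i k) ->
    P N.*2 = false -> P N.*2.+1 = ~~ odd k -> half_pattern N.+1.*2 P.
  move=> kN Pk e1 e2; right; exists k, t; split; first by rewrite doubleS; lia.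
  have k1 : (N.*2 == k) = false by lia.
  have k2 : (N.*2.+1 == k) = false by lia.
  have k3 : (N.*2 < k) = false by lia.
  have k4 : (N.*2.+1 < k) = false by lia.
  have k5 : k < N.*2.+1 by lia.
  move=> i /split_i[/Pk -> //|->|->].
    by rewrite e1 k1 half_symE k3 odd_double !andbF.
  by rewrite e2 k2 half_symE k4 k5 /= odd_double andbT.
case: IH' => [[b Pb]|[k [t [kN Pk]]]].
  have := lastw 0 isT.
  rewrite (Pb 0.*2) // (Pb 0.*2.+1) // (Pb n.+2.*2) // (Pb n.+2.*2.+1) //; case: b Pb => Pb.
    move=> /w1/andP[e1 e2]; left; exists true => i /split_i[/Pb -> //|->|->] //.
  move=> /w0; case E2: (P N.*2.+1); last first.
    rewrite implybF => /negbTE E1; left; exists false => i /split_i[/Pb -> //|->|->] //.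
  (* A pattern that was constantly false turns out to be a twin of the new even position. *)
  move=> _; right; exists N.*2, (P N.*2); split; first by rewrite doubleS; lia.
  move=> i /split_i[iN|->|->].
  - rewrite Pb // (ltn_eqF iN) half_symE odd_double !andbF /=.
    by have -> : (N.*2 < i) = false by lia.
  - by rewrite eqxx.
  - have -> : (N.*2.+1 == N.*2) = false by lia.
    by rewrite E2 half_symE ltnSn /= odd_double orbT.
have kE := odd_double_half k; set j := k./2 in kE.
have jn : j < N by lia.
have [jn2|jn2] := ltnP j n.+2.
  have j0 : j.*2 < N.*2 by lia.
  have j1 : j.*2.+1 < N.*2 by lia.
  have := lastw _ jn2.
  rewrite (Pk j.*2) // (Pk j.*2.+1) // (Pk n.+2.*2) // (Pk n.+2.*2.+1) //.
  have [ok|ek] := boolP (odd k).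
    have E : k = j.*2.+1 by rewrite -kE ok.
    rewrite [j.*2.+1 == k](introT eqP) // !half_symE ok /= !odd_double /=.
    have -> : (j.*2 == k) = false by lia.
    have -> : (n.+2.*2 == k) = false by lia.
    have -> : (n.+2.*2.+1 == k) = false by lia.
    have -> : j.*2 < k by lia.
    have -> : (n.+2.*2 < k) = false by lia.
    rewrite !andbF /= => /wo/andP[/negbTE e1 /negbTE e2].
    by apply: (twin k t); rewrite // ok.
  have E : k = j.*2 by rewrite -kE (negbTE ek).
  rewrite [j.*2 == k](introT eqP) // !half_symE (negbTE ek) /= !odd_double /=.
  have -> : (j.*2.+1 == k) = false by lia.
  have -> : (n.+2.*2 == k) = false by lia.
  have -> : (n.+2.*2.+1 == k) = false by lia.
  have -> : k < j.*2.+1 by lia.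
  have -> : k < n.+2.*2.+1 by lia.
  rewrite !andbF /= => /we/andP[/negbTE e1 e2].
  by apply: (twin k t); rewrite // ek.
have Ej : j = n.+2 by rewrite /N in jn; lia.
have := lastw 0 isT.
rewrite (Pk 0.*2) // (Pk 0.*2.+1) // (Pk n.+2.*2) // (Pk n.+2.*2.+1) //.
have [ok|ek] := boolP (odd k).
  have E : k = n.+2.*2.+1 by rewrite -kE ok Ej.
  rewrite [n.+2.*2.+1 == k](introT eqP) // !half_symE ok /= !odd_double /=.
  have -> : (0 == k) = false by lia.
  have -> : (1 == k) = false by lia.
  have -> : (n.+2.*2 == k) = false by lia.
  have -> : 0 < k by lia.
  have -> : n.+2.*2 < k by lia.
  rewrite !andbF /= => /wo2; case: t Pk => Pk.
    by move=> /andP[/negbTE e1 /negbTE e2]; apply: (twin k true); rewrite // ok.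
  case e1: (P N.*2); last first.
    by rewrite implybF => /negbTE e2; apply: (twin k false); rewrite // ok.
  (* With [t] false, a twin of the last old odd position looks so far like a twin of the new odd
     one. *)
  move=> _; right; exists N.*2.+1, (P N.*2.+1); split; first by rewrite doubleS; lia.
  move=> i /split_i[iN|->|->].
  - have -> : (i == N.*2.+1) = false by lia.
    rewrite Pk // !half_symE /= odd_double ok /=.
    have -> : i < N.*2.+1 by lia.
    case: eqP => [->|/eqP ik]; first by rewrite ok !andbF.
    have [oi|ei] := boolP (odd i); first by rewrite !andbF.
    suff -> : i < k by [].
    by lia.
  - have -> : (N.*2 == N.*2.+1) = false by lia.
    by rewrite e1 half_symE ltnSn /= odd_double.
  - by rewrite eqxx.
have E : k = n.+2.*2 by rewrite -kE (negbTE ek) Ej.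
rewrite [n.+2.*2 == k](introT eqP) // !half_symE (negbTE ek) /= !odd_double /=.
have -> : (0 == k) = false by lia.
have -> : (1 == k) = false by lia.
have -> : (n.+2.*2.+1 == k) = false by lia.
have -> : (k < 1) = false by lia.
have -> : k < n.+2.*2.+1 by lia.
rewrite !andbF /= => /we2/andP[/negbTE e1 e2].
by apply: (twin k t); rewrite // ek.
Qed.

Lemma extend_pair n u v : 2 < n -> u < v -> v < n ->
  exists i j k, [/\ i < j, j < k, k < n, u \in [:: i; j; k] & v \in [:: i; j; k]].
Proof.
move=> n2 uv vn; case: u uv => [|u] uv; last first.
  by exists 0, u.+1, v; rewrite !inE !eqxx !orbT.
have [v1|v1] := leqP v 1.
  by exists 0, v, 2; split; rewrite ?inE ?eqxx ?orbT //; lia.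
by exists 0, 1, v; rewrite !inE !eqxx !orbT.
Qed.

(** This serves to put three given positions, through their pairs, into one induced half graph on
    six vertices. *)
Lemma extend_triple n u v w : 2 < n -> u < n -> v < n -> w < n ->
  exists i j k, [/\ i < j, j < k, k < n &
    [/\ u \in [:: i; j; k], v \in [:: i; j; k] & w \in [:: i; j; k]]].
Proof.
move=> n2 un vn wn.
have two a b : a < n -> b < n ->
    exists i j k, [/\ i < j, j < k, k < n, a \in [:: i; j; k] & b \in [:: i; j; k]].
  move=> an bn; have [ab|ba|->] := ltngtP a b.
  - exact: extend_pair.
  - by have [i [j [k [? ? ? ? ?]]]] := extend_pair n2 ba an; exists i, j, k.
  - case: b bn => [|b] bn.
      by exists 0, 1, 2.
    by have [i [j [k [? ? ? ? ?]]]] := extend_pair n2 (ltn0Sn b) bn; exists i, j, k.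
have two' a b : a < n -> b < n -> [|| u == a, u == b | u == v] ->
   (v == a) || (v == b) -> (w == a) || (w == b) -> exists i j k, [/\ i < j, j < k, k < n &
    [/\ u \in [:: i; j; k], v \in [:: i; j; k] & w \in [:: i; j; k]]].
  move=> an bn hu hv hw; have [i [j [k [? ? ? ha hb]]]] := two a b an bn.
  have V : v \in [:: i; j; k] by case/orP: hv => /eqP ->.
  exists i, j, k; split => //; split => //.
    by case/or3P: hu => /eqP ->.
  by case/orP: hw => /eqP ->.
have [uv|vu|E] := ltngtP u v; last by apply: (two' v w); rewrite ?E ?eqxx ?orbT.
- have [uw|wu|E] := ltngtP u w; last by apply: (two' u v); rewrite ?E ?eqxx ?orbT.
  + have [vw|wv|E] := ltngtP v w; last by apply: (two' u v); rewrite ?E ?eqxx ?orbT.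
    * by exists u, v, w; rewrite !inE !eqxx !orbT.
    * by exists u, w, v; rewrite !inE !eqxx !orbT.
  + by exists w, u, v; rewrite !inE !eqxx !orbT.
- have [uw|wu|E] := ltngtP u w; last by apply: (two' u v); rewrite ?E ?eqxx ?orbT.
  + by exists v, u, w; rewrite !inE !eqxx !orbT.
  + have [vw|wv|E] := ltngtP v w; last by apply: (two' u v); rewrite ?E ?eqxx ?orbT.
    * by exists v, w, u; rewrite !inE !eqxx !orbT.
    * by exists w, v, u; rewrite !inE !eqxx !orbT.
Qed.

Definition pairs6 i j k := [:: i.*2; i.*2.+1; j.*2; j.*2.+1; k.*2; k.*2.+1].

Lemma pairs6P i j k n : i < j -> j < k -> k < n ->
  [/\ size (pairs6 i j k) = 6, sorted ltn (pairs6 i j k), all (fun p => p < n.*2) (pairs6 i j k) &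
      forall p, p < 6 -> odd (nth 0 (pairs6 i j k) p) = odd p].
Proof.
move=> ij jk kn; split=> //.
- by rewrite /= !andbT; apply/and5P; split; lia.
- by rewrite /= !andbT; do !(apply/andP; split); lia.
- by do 6?[case=> [|] //=]; rewrite ?odd_double.
Qed.

Lemma mem_pairs6 i j k p : p./2 \in [:: i; j; k] -> p \in pairs6 i j k.
Proof.
have E := odd_double_half p; rewrite !inE.
case/or3P => /eqP Ei; rewrite Ei in E; rewrite -E; case: (odd p);
  by rewrite ?add1n ?add0n eqxx ?orbT.
Qed.

(** * Maximal half graphs *)

Section HalfGraphs.
Variables (T : finType) (x0 : T) (e : rel T) (S : {set T}).
Hypothesis e_sym : symmetric e.
Hypothesis gdS : good_on e S.
Local Notation mat := (mat x0).
Local Notation "s `_ i" := (nth x0 s i).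

Definition half_seq s := mat e s = half_mat false (size s).

Lemma half_seqP s : half_seq s <->
  forall i j, i < j -> j < size s -> e (s`_j) (s`_i) = half_rel i j.
Proof. by split=> [/matP H i j ij js|H]; [apply: H|apply/matP]. Qed.

Lemma half_seq_sym s i j : half_seq s -> i < size s -> j < size s -> i != j ->
  e (s`_i) (s`_j) = half_sym j i.
Proof.
move=> /half_seqP H is_ js; rewrite /half_sym; case: ltngtP => // ij _; first exact: H.
by rewrite e_sym; apply: H.
Qed.

(* l selects an induced half graph on six vertices. *)
Definition sub6 n l := [/\ size l = 6, sorted ltn l, all (fun p => p < n) l &
  forall p, p < 6 -> odd (nth 0 l p) = odd p].

Definition sub s l := [seq s`_i | i <- l].

Lemma sub6_lt n l p q : sub6 n l -> p < 6 -> q < 6 -> (nth 0 l p < nth 0 l q) = (p < q).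
Proof.
move=> [l6 sl _ _] p6 q6.
have mono a b : a < 6 -> b < 6 -> a < b -> nth 0 l a < nth 0 l b.
  by move=> a6 b6; apply: (sorted_ltn_nth ltn_trans) => //; rewrite inE l6.
have [pq|qp|->] := ltngtP p q; last by rewrite ltnn.
  by apply: mono.
by apply/negbTE; rewrite -leqNgt ltnW // mono.
Qed.

Lemma sub6_half_sym n l p q : sub6 n l -> p < 6 -> q < 6 ->
  half_sym (nth 0 l p) (nth 0 l q) = half_sym p q.
Proof.
move=> L p6 q6; rewrite !half_symE !(sub6_lt L) //.
by case: L => _ _ _ od; rewrite !od.
Qed.

Lemma sub6_uniq n l : sub6 n l -> uniq l.
Proof. by case=> _ + _ _; rewrite ltn_sorted_uniq_leq => /andP[]. Qed.

Lemma sub6_mem n a b c : 2 < n -> a < n.*2 -> b < n.*2 -> c < n.*2 ->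
  exists l, [/\ sub6 n.*2 l, a \in l, b \in l & c \in l].
Proof.
move=> n2 an bn cn.
have [||| i [j [k [ij jk kn [ia ib ic]]]]] := @extend_triple n a./2 b./2 c./2 n2; try lia.
by exists (pairs6 i j k); split; [exact: pairs6P|exact: mem_pairs6..].
Qed.

Definition insert2 (s : seq T) p a b := take p s ++ a :: b :: drop p s.

Lemma nth_insert2 s p a b i : p <= size s -> (insert2 s p a b)`_i =
  if i < p then s`_i else if i == p then a else if i == p.+1 then b else s`_(i - 2).
Proof.
move=> ps; rewrite /insert2 nth_cat size_takel //; case: ltnP => [ip|pi].
  by rewrite nth_take.
have -> : i = p + (i - p) by rewrite subnKC.
case: (i - p) => [|[|m]].
- by rewrite addn0 subnn eqxx.
- by rewrite addn1 subSnn eqxx (gtn_eqF (ltnSn p)).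
- have -> : (p + m.+2 == p) = false by lia.
  have -> : (p + m.+2 == p.+1) = false by lia.
  have -> : p + m.+2 - p = m.+2 by lia.
  by rewrite /= nth_drop; congr nth; lia.
Qed.

(** Two new entries shift the later ones by an even amount, so parity and order, and with them
    [half_rel], survive. *)
Lemma half_seq_insert2 s p a b : half_seq s -> p <= size s ->
  (forall i, i < p -> e a (s`_i) = half_rel i p) ->
  (forall i, p <= i -> i < size s -> e a (s`_i) = half_rel p i) ->
  (forall i, i < p -> e b (s`_i) = half_rel i p.+1) ->
  (forall i, p <= i -> i < size s -> e b (s`_i) = half_rel p.+1 i) ->
  e b a = half_rel p p.+1 -> half_seq (insert2 s p a b).
Proof.
move=> hs ps a1 a2 b1 b2 ab; apply/half_seqP => i j ij.
have -> : size (insert2 s p a b) = (size s).+2.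
  by rewrite /insert2 size_cat /= size_takel // size_drop; lia.
move=> js; rewrite !nth_insert2 //; move/half_seqP: hs => H.
have shift q : 1 < q -> odd (q - 2) = odd q by move=> q1; rewrite oddB // addbF.
have [jp|pj] := ltnP j p.
  by rewrite (ltn_trans ij jp) H // (leq_trans jp ps).
have [ip|pi] := ltnP i p.
  have [->|jp] := eqVneq j p; first exact: a1.
  have [->|jp1] := eqVneq j p.+1; first exact: b1.
  rewrite H; [|by lia|by lia].
  by rewrite /half_rel shift //; lia.
have [jp|jp] := eqVneq j p; first by lia.
have [ip|ip] := eqVneq i p; have [jp1|jp1] := eqVneq j p.+1.
- by rewrite ip jp1.
- rewrite e_sym a2; [|by lia|by lia].
  by rewrite ip /half_rel shift //; lia.
- by lia.
- have [ip1|ip1] := eqVneq i p.+1.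
    rewrite e_sym b2; [|by lia|by lia].
    by rewrite ip1 /half_rel shift //; lia.
  rewrite H; [|by lia|by lia].
  by rewrite /half_rel !shift //; lia.
Qed.

Section FixedHalf.
Variables (s : seq T) (n : nat).
Hypotheses (us : uniq s) (sS : {subset s <= S}) (sn : size s = n.*2) (n2 : 2 < n).
Hypothesis hs : half_seq s.

Lemma sub6_uniq_sub l : sub6 n.*2 l -> uniq (sub s l).
Proof.
move=> L; rewrite map_inj_in_uniq ?(sub6_uniq L) // => i j.
case: L => _ _ /allP l_n _ /l_n il /l_n jl /eqP.
by rewrite nth_uniq ?sn // => /eqP.
Qed.

Lemma sub6_sub l : sub6 n.*2 l -> {subset sub s l <= s}.
Proof.
case=> _ _ /allP l_n _ x /mapP[i /l_n i_n ->].
by rewrite mem_nth // sn.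
Qed.

Lemma mat_sub6 l : sub6 n.*2 l -> mat e (sub s l) = half_mat false 6.
Proof.
move=> L; have [l6 _ /allP l_n od] := L.
have lt a : a < 6 -> nth 0 l a < size s by move=> a6; rewrite sn l_n // mem_nth ?l6.
have -> : 6 = size (sub s l) by rewrite size_map.
apply/matP => i j ij; rewrite size_map l6 => j6.
have i6 := ltn_trans ij j6.
rewrite !(nth_map 0) ?l6 //; move/half_seqP: hs => ->; rewrite ?(sub6_lt L) ?lt //.
by rewrite /half_rel !od.
Qed.

Lemma sub6_word l v : sub6 n.*2 l -> v \in S -> v \notin s ->
  [seq e v (s`_i) | i <- l] \in half_words.
Proof.
move=> L vS vs; have [l6 _ _ _] := L.
have := @goodm_mat _ x0 _ e_sym S (sub s l) v gdS.
rewrite rcons_uniq (sub6_uniq_sub L) andbT => H.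
have {}H : goodm (mat e (rcons (sub s l) v)).
  apply: H; first by apply: contra vs; apply: sub6_sub.
  by move=> x; rewrite mem_rcons in_cons => /orP[/eqP -> //|/(sub6_sub L)/sS].
move: H; rewrite mat_rcons mat_sub6 // -map_comp => H.
have := allP half6_words [seq e v (s`_i) | i <- l].
by rewrite mem_bits size_map l6 eqxx => /(_ isT) /implyP; apply.
Qed.

Lemma sub6_pair l x y : sub6 n.*2 l -> x \in S -> y \in S -> x \notin s -> y \notin s ->
  x != y -> goodm (rcons (rcons (half_mat false 6) [seq e x (s`_i) | i <- l])
                    (rcons [seq e y (s`_i) | i <- l] (e y x))).
Proof.
move=> L xS yS xs ys xy; have [l6 _ _ _] := L.
have ss := sub6_sub L.
have xl : x \notin sub s l by apply: contra xs; apply: ss.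
have yl : y \notin sub s l by apply: contra ys; apply: ss.
have := @goodm_mat _ x0 _ e_sym S (rcons (sub s l) x) y gdS.
rewrite !rcons_uniq (sub6_uniq_sub L) xl mem_rcons in_cons negb_or eq_sym xy yl.
move=> /(_ isT); rewrite !mat_rcons mat_sub6 // map_rcons -!map_comp; apply.
by move=> z; rewrite !(mem_rcons, in_cons) => /or3P[/eqP ->|/eqP ->|/ss/sS].
Qed.

Lemma half_type v : v \in S -> v \notin s ->
  half_pattern n.*2 (fun i => e v (s`_i)).
Proof.
move=> vS vs; case: n n2 sn (@sub6_word) => [|[|[|m]]] // _ _ W.
apply: half_pattern_of_triples => i j k ij jk kn.
exact: (W (pairs6 i j k)) (pairs6P ij jk kn) vS vs.
Qed.

Lemma twin_pattern_word P k t l : sub6 n.*2 l -> k \in l -> twin_pattern n.*2 P k t ->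
  [seq P i | i <- l] = twin_word (index k l) t.
Proof.
move=> L kl [kn Pk]; have [l6 _ /allP l_n _] := L.
have k6 : index k l < 6 by rewrite -l6 index_mem.
apply: (@eq_from_nth _ false); rewrite size_map l6 ?size_mkseq // => p p6.
rewrite (nth_map 0) ?l6 // nth_mkseq // Pk ?l_n ?mem_nth ?l6 //.
rewrite -{1 2}(nth_index 0 kl) nth_uniq ?l6 ?(sub6_uniq L) //.
by rewrite (sub6_half_sym L).
Qed.

Lemma twin_twin_step x y k t l u : x \in S -> y \in S -> x \notin s -> y \notin s -> x != y ->
  twin_pattern n.*2 (fun i => e x (s`_i)) k t ->
  twin_pattern n.*2 (fun i => e y (s`_i)) l u ->
  k < l -> e y x = ~~ half_sym k l -> [/\ l = k.+1, t = false & u = false].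
Proof.
move=> xS yS xs ys xy tx ty kl exy.
have [kn ln] : k < n.*2 /\ l < n.*2 by case: tx; case: ty.
(* With [k.+1] in [L], consecutive indices of [k] and [l] in [L] mean consecutive positions:
   otherwise [k.+1] would lie strictly between them. *)
have [L [L6 kL lL k1L]] := sub6_mem n2 kn ln (leq_ltn_trans kl ln).
have [s6 srt _ _] := L6.
have k6 : index k L < 6 by rewrite -s6 index_mem.
have l6 : index l L < 6 by rewrite -s6 index_mem.
have := sub6_pair L6 xS yS xs ys xy.
rewrite (twin_pattern_word L6 kL tx) (twin_pattern_word L6 lL ty) exy.
have -> : half_sym k l = half_sym (index k L) (index l L).
  by rewrite -(sub6_half_sym L6 k6 l6) !nth_index.
move=> G; have kl' : index k L < index l L by rewrite -(sub6_lt L6 k6 l6) !nth_index.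
have mi p : p < 6 -> p \in iota 0 6 by rewrite mem_iota.
have mb (b : bool) : b \in [:: false; true] by case: b.
have := half6_twin_twin => /allP/(_ _ (mi _ k6))/allP/(_ _ (mi _ l6)).
move=> /allP/(_ _ (mb t))/allP/(_ _ (mb u)); rewrite kl' G /=.
move=> /and3P[/eqP E /negbTE -> /negbTE ->]; split=> //.
have i1 : index k.+1 L < 6 by rewrite -s6 index_mem.
have a1 : index k L < index k.+1 L by rewrite -(sub6_lt L6 k6 i1) !nth_index.
apply/eqP; rewrite eqn_leq kl andbT -ltnS.
have [//|le] := ltnP l k.+2.
have : index k.+1 L < index l L by rewrite -(sub6_lt L6 i1 l6) !nth_index.
by rewrite E ltnS leqNgt a1.
Qed.

Lemma twin_const_step x y k t b : x \in S -> y \in S -> x \notin s -> y \notin s -> x != y ->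
  twin_pattern n.*2 (fun i => e x (s`_i)) k t ->
  (forall i, i < n.*2 -> e y (s`_i) = b) -> e y x = ~~ b ->
  [/\ b = false, t = false & k = 0 \/ k = n.*2.-1].
Proof.
move=> xS yS xs ys xy tx cy exy.
have kn : k < n.*2 by case: tx.
have z0 : 0 < n.*2 by lia.
have m0 : n.*2.-1 < n.*2 by lia.
(* With both end positions in [L], the first or last index in [L] belongs to an end of the whole
   half graph. *)
have [L [L6 kL oL mL]] := sub6_mem n2 kn z0 m0.
have [s6 srt /allP Ln _] := L6.
have k6 : index k L < 6 by rewrite -s6 index_mem.
have o6 : index 0 L < 6 by rewrite -s6 index_mem.
have m6 : index n.*2.-1 L < 6 by rewrite -s6 index_mem.
have := sub6_pair L6 xS yS xs ys xy.
rewrite (twin_pattern_word L6 kL tx) exy.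
have -> : [seq e y (s`_i) | i <- L] = nseq 6 b.
  rewrite -s6; apply: (@eq_from_nth _ false); rewrite size_map ?size_nseq // => p pL.
  by rewrite (nth_map 0) // nth_nseq pL cy // Ln // mem_nth.
have mi p : p < 6 -> p \in iota 0 6 by rewrite mem_iota.
have mb (c : bool) : c \in [:: false; true] by case: c.
move=> G; have := half6_twin_const => /allP/(_ _ (mi _ k6)).
move=> /allP/(_ _ (mb t))/allP/(_ _ (mb b)); rewrite G implyTb.
move=> /and3P[/negbTE -> /negbTE -> H]; split=> //.
case/orP: H => /eqP E; [left|right].
  have := sub6_lt L6 o6 k6; rewrite !nth_index // E ltn0 => /negbT.
  by rewrite -leqNgt leqn0 => /eqP.
have := sub6_lt L6 k6 m6; rewrite !nth_index // E.
have -> : (5 < index n.*2.-1 L) = false by apply/negbTE; rewrite -leqNgt.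
move=> /negbT.
by rewrite -leqNgt => h; apply/eqP; rewrite eqn_leq h andbT -ltnS prednK.
Qed.

Lemma twin_patternP v k t : twin_pattern n.*2 (fun i => e v (s`_i)) k t ->
  twin_on e [set x in s] v (s`_k).
Proof.
move=> [kn Pk]; split; first by rewrite inE mem_nth ?sn.
move=> z; rewrite inE => zs zk; set i := index z s.
have is_ : i < size s by rewrite index_mem.
have zE : z = s`_i by rewrite nth_index.
have ik : i != k by apply: contraNneq zk => <-; rewrite zE.
rewrite zE Pk -?sn // (negPf ik); apply/esym/(half_seq_sym hs) => //; rewrite ?sn // 1?eq_sym //.
Qed.
End FixedHalf.

Definition prime_half_seq n s :=
  [/\ uniq s, {subset s <= S}, size s = n.*2, half_seq s & prime_set e [set x in s]].

Lemma half_grow n s : 2 < n -> prime_set e S -> prime_half_seq n s -> [set x in s] <> S ->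
  exists s', prime_half_seq n.+1 s'.
Proof.
move=> n2 pS [us sS sn hs ps] neS; set X := [set x in s].
have cX : #|X| = n.*2 by rewrite cardsE; move/card_uniqP: us => ->.
have cX2 : 2 < #|X| by rewrite cX; clear -n2; lia.
have XS : X \subset S by apply/subsetP => x; rewrite inE => /sS.
have type v : v \in S -> v \notin s -> uniform_on e X v \/
    exists k t, twin_pattern n.*2 (fun i => e v (s`_i)) k t.
  move=> vS vs; have [[b Pb]|H] := half_type us sS sn n2 hs vS vs; last by right.
  left=> y z; rewrite !inE => ys zs.
  by rewrite -(nth_index x0 ys) -(nth_index x0 zs) !Pb // -sn index_mem.
have twin v k t := @twin_patternP _ _ sn hs v k t.
have inX v : (v \in X) = (v \in s) by rewrite inE.
have const v : uniform_on e X v -> exists b, forall i, i < n.*2 -> e v (s`_i) = b.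
  move=> U; exists (e v (s`_0)) => i i_n; apply: U; rewrite inX mem_nth ?sn //; clear -n2; lia.
have cSX : 0 < #|S :\: X|.
  rewrite card_gt0 setD_eq0; apply: contra_notN neS => SX.
  by apply/eqP; rewrite eqEsubset XS.
(* A single missing vertex is impossible: being uniform or a twin, it would make [S] non-prime. *)
have [c1|c2] := leqP #|S :\: X| 1.
  have /cards1P[v Ev] : #|S :\: X| == 1 by rewrite eqn_leq c1 cSX.
  have : v \in S :\: X by rewrite Ev inE.
  rewrite inE inX => /andP[vs vS].
  have SE : S = v |: X by rewrite -Ev setUC setDE setUIr setUCr setIT (setUidPr XS).
  have vX : v \notin X by rewrite inX.
  have pv : prime_set e (v |: X) by rewrite -SE.
  have [nU nT] := prime_set1_not_type e_sym vX cX2 pv.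
  by case: (type v vS vs) => [/nU //|[k [t /twin/nT]]].
have [x [y [xSX ySX xy pxy]]] := prime_add2 e_sym pS ps XS cX2 c2.
move: xSX ySX; rewrite !inE => /andP[xs xS] /andP[ys yS].
have xX : x \notin X by rewrite inX.
have yX : y \notin X by rewrite inX.
have [nUU nTx nTy nTT] := prime_pair_types e_sym xX yX xy cX2 pxy.
have grow p a b : (a == x) && (b == y) || (a == y) && (b == x) -> p <= size s ->
    half_seq (insert2 s p a b) -> exists s', prime_half_seq n.+1 s'.
  move=> ab ps' hs'; exists (insert2 s p a b).
  have memE z : (z \in insert2 s p a b) = (z \in x |: (y |: X)).
    rewrite !inE mem_cat !in_cons -{3}(cat_take_drop p s) mem_cat.
    case/orP: ab => /andP[/eqP -> /eqP ->];
      by case: (z == x); case: (z == y); rewrite ?orbT.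
  have sz : size (insert2 s p a b) = n.+1.*2.
    by rewrite doubleS -sn /insert2 size_cat /= size_takel // size_drop !addnS subnKC.
  split=> //.
  - by apply/card_uniqP; rewrite sz (eq_card memE) !cardsU1 !inE negb_or xy xs ys cX doubleS /= !add1n.
  - by move=> z; rewrite memE !inE => /or3P[/eqP ->|/eqP ->|/sS].
  - have -> : [set z in insert2 s p a b] = x |: (y |: X).
      by apply/setP => z; rewrite inE memE.
    exact: pxy.
have half_nsym a b : half_rel a b = ~~ odd a && odd b by [].
(* [a] is a twin of an end, [b] sees nothing of [s]: [a, b] goes in front at position 0, [b, a]
   behind at the last position. *)
have const_case a b k t c : (a == x) && (b == y) || (a == y) && (b == x) ->
    a \in S -> b \in S -> a \notin s -> b \notin s -> a != b ->
    twin_pattern n.*2 (fun i => e a (s`_i)) k t ->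
    (forall i, i < n.*2 -> e b (s`_i) = c) -> e b a != e b (s`_k) ->
    exists s', prime_half_seq n.+1 s'.
  move=> E aS bS as_ bs ab ta cb ne.
  have kn : k < n.*2 by case: ta.
  have eba : e b a = ~~ c by move: ne; rewrite cb //; case: (e b a); case: (c).
  have [Ec Et Ek] := twin_const_step us sS sn n2 hs aS bS as_ bs ab ta cb eba.
  rewrite {}Ec in cb eba; rewrite {}Et in ta; case: ta => _ ta.
  case: Ek => Ek; rewrite {}Ek in ta ne kn.
    apply: (grow 0 a b) => //; apply: half_seq_insert2 => // i _; rewrite sn => i_n.
      by rewrite ta // half_symE ltn0; case: (eqVneq i 0) => [->|i0] //=; rewrite lt0n i0.
    by rewrite cb.
  apply: (grow n.*2 b a); rewrite ?sn //.
    by rewrite orbC andbC [X in _ || X]andbC.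
  apply: (half_seq_insert2 hs).
  - by rewrite sn.
  - by move=> i i_n; rewrite cb // half_nsym odd_double andbF.
  - by move=> i ni; rewrite sn ltnNge ni.
  - move=> i i_n; rewrite ta // half_symE half_nsym /= odd_double.
    have oddp : odd n.*2.-1 by clear -n2; lia.
    rewrite oddp; case: (eqVneq i n.*2.-1) => [->|ne']; first by rewrite oddp.
    have -> : i < n.*2.-1 by clear -i_n ne'; lia.
    by rewrite andbF orbF.
  - by move=> i ni; rewrite sn ltnNge ni.
  - by rewrite e_sym eba half_nsym /= odd_double.
(* [a] is a twin of [k] and [b] of [k.+1]; they are inserted between the two crosswise, as [b, a],
   so that the parities alternate. *)
have twin_case a b k l t u : (a == x) && (b == y) || (a == y) && (b == x) ->
    a \in S -> b \in S -> a \notin s -> b \notin s -> a != b ->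
    twin_pattern n.*2 (fun i => e a (s`_i)) k t ->
    twin_pattern n.*2 (fun i => e b (s`_i)) l u -> k < l ->
    e b a != e b (s`_k) -> exists s', prime_half_seq n.+1 s'.
  move=> E aS bS as_ bs ab ta tb kl ne.
  have kn : k < n.*2 by case: ta.
  have eba : e b a = ~~ half_sym k l.
    by move: ne; case: tb => _ ->//; rewrite (ltn_eqF kl); case: (e b a); case: half_sym.
  have [El Et Eu] := twin_twin_step us sS sn n2 hs aS bS as_ bs ab ta tb kl eba.
  rewrite {}El {}Eu in tb eba kl; rewrite {}Et in ta.
  case: ta tb => _ ta [k1n tb].
  apply: (grow k.+1 b a); rewrite ?sn //; first by rewrite orbC andbC [X in _ || X]andbC.
  apply: (half_seq_insert2 hs).
  - by rewrite sn ltnW.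
  - move=> i ik; rewrite tb ?half_symE ?ik; last exact: ltn_trans k1n.
    rewrite (ltn_eqF ik) half_nsym; have -> : (k.+1 < i) = false by clear -ik; lia.
    by rewrite orbF.
  - move=> i ki; rewrite sn => i_n; rewrite tb // half_symE half_nsym; case: (eqVneq i k.+1) => [->|ik].
      by rewrite andNb.
    have -> : k.+1 < i by clear -ki ik; lia.
    by have -> : (i < k.+1) = false by clear -ki; lia.
  - move=> i ik; rewrite ta; last exact: ltn_trans k1n.
    rewrite half_symE half_nsym /= negbK; case: (eqVneq i k) => [->|ne']; first by case: odd.
    have -> : i < k by clear -ik ne'; lia.
    have -> : (k < i) = false by clear -ik; lia.
    by rewrite orbF.
  - move=> i ki; rewrite sn => i_n; rewrite ta // half_symE half_nsym /= negbK.
    have -> : (i == k) = false by clear -ki; lia.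
    have -> : (i < k) = false by clear -ki; lia.
    by rewrite ki.
  - rewrite e_sym eba half_symE half_nsym ltnSn; have -> : (k.+1 < k) = false by clear; lia.
    by rewrite orbF /= negbK; case: (odd k).
have yx : y != x by rewrite eq_sym.
have Exy : (x == x) && (y == y) || (x == y) && (y == x) by rewrite !eqxx.
have Eyx : (y == x) && (x == y) || (y == y) && (x == x) by rewrite !eqxx orbT.
case: (type x xS xs) => [Ux|[k [t tx]]]; case: (type y yS ys) => [Uy|[l [u ty]]].
- by case: nUU.
- have [b cb] := const _ Ux.
  by apply: (const_case y x l u b Eyx); rewrite // nTy //; apply: twin ty.
- have [b cb] := const _ Uy.
  by apply: (const_case x y k t b Exy); rewrite // nTx //; apply: twin tx.
- have tkx := twin _ _ _ tx; have tly := twin _ _ _ ty.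
  have [kl|lk|E] := ltngtP k l.
  + by apply: (twin_case x y k l t u Exy) => //; apply: nTx.
  + by apply: (twin_case y x l k u t Eyx) => //; apply: nTy.
  + by case: (nTT _ tkx); rewrite E.
Qed.

Lemma half_maximal n s : 2 < n -> prime_set e S -> prime_half_seq n s ->
  exists s', [/\ uniq s', 0 < size s', half_seq s' & [set x in s'] = S].
Proof.
move=> n2 pS; have [m] := ubnP (#|S| - n); elim: m n n2 s => // m IH n n2 s Sm H.
have [E|neS] := EM ([set x in s] = S).
  by case: H => us _ sn hs _; exists s; split => //; rewrite sn; clear -n2; lia.
have [s' H'] := half_grow n2 pS H neS.
apply: (IH n.+1 _ s') => //; first by lia.
have : n.+1.*2 <= #|S|.
  case: H' => us sS <- _ _; rewrite -(card_uniqP us).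
  by apply: subset_leq_card; apply/subsetP.
by lia.
Qed.
End HalfGraphs.

(** * Maximal spiders *)

Section Spiders.
Variables (T : finType) (x0 : T) (e : rel T) (S : {set T}).
Hypothesis e_sym : symmetric e.
Hypothesis spe : sparse x0 e.
Local Notation mat := (mat x0).
Local Notation "s `_ i" := (nth x0 s i).

Definition spider_seq s := mat e s = spider_mat false (size s).

Lemma spider_seqP s : spider_seq s <->
  forall i j, i < j -> j < size s -> e (s`_j) (s`_i) = spider_rel i j.
Proof. by split=> [/matP H i j ij js|H]; [apply: H|apply/matP]. Qed.

(** Each further leg, the first leg and the centre form a five-vertex spider for [spider5_words];
    the shared first leg makes the value [b] common to all legs. *)
Lemma spider_type n s v : uniq s -> size s = n.*2.+1 -> 1 < n -> spider_seq s -> v \notin s ->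
  exists a b, [/\ e v (s`_0) = a, forall i, 0 < i -> i < size s -> e v (s`_i) = b & b ==> a].
Proof.
move=> us sn n1 /spider_seqP hs vs.
have word j : 0 < j -> j < n ->
    [:: e v (s`_0); e v (s`_1); e v (s`_2); e v (s`_j.*2.+1); e v (s`_j.*2.+2)] \in
    [:: nseq 5 false; nseq 5 true; true :: nseq 4 false].
  move=> j0 jn; set L := [:: 0; 1; 2; j.*2.+1; j.*2.+2].
  have Ls i : i \in L -> i < size s by rewrite sn !inE; lia.
  have uL : uniq L by rewrite /= !inE; lia.
  have uY : uniq [seq s`_i | i <- L].
    rewrite map_inj_in_uniq // => a b /Ls aL /Ls bL /eqP.
    by rewrite nth_uniq // => /eqP.
  have mY : mat e [seq s`_i | i <- L] = spider_mat false 5.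
    have -> : 5 = size [seq s`_i | i <- L] by [].
    apply/matP => a b ab; rewrite size_map => bL.
    rewrite !(nth_map 0) //; last exact: ltn_trans bL.
    have bs := Ls _ (mem_nth 0 bL).
    have lt : nth 0 L a < nth 0 L b.
      apply: (sorted_ltn_nth ltn_trans) => //; last by rewrite inE (ltn_trans ab).
      by rewrite /L /= !ltnS; lia.
    rewrite hs //; move: ab bL {bs lt}; rewrite /L /spider_rel.
    case: b => [|[|[|[|[|b]]]]] //; case: a => [|[|[|[|a]]]] // _ _ /=;
      rewrite ?odd_double ?eqSS ?andbF ?orbF //; lia.
  have vY : v \notin [seq s`_i | i <- L].
    by apply: contra vs => /mapP[i /Ls i_s ->]; apply: mem_nth.
  have := @sparsem_mat _ x0 e e_sym [seq s`_i | i <- L] v spe.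
  rewrite rcons_uniq vY uY => /(_ isT); rewrite mat_rcons mY -map_comp => H.
  have := allP spider5_words [seq e v (s`_i) | i <- L].
  by rewrite mem_bits size_map => /(_ isT)/implyP; apply.
exists (e v (s`_0)), (e v (s`_1)); split=> //; last first.
  by move: (word 1 isT n1); case: (e v (s`_1)); case: (e v (s`_0)).
move=> i i0 is_; have [|j0] := posnP (i.-1)./2.
  have := word 1 isT n1; move=> W i1.
  have [->|->] : i = 1 \/ i = 2 by lia.
    by [].
  by move: W; do 3!case: (e v _).
have jn : (i.-1)./2 < n by lia.
have := word _ j0 jn; set j := (i.-1)./2.
have [->|->] : i = j.*2.+1 \/ i = j.*2.+2 by rewrite /j; lia.
  by do 4!case: (e v _).
by do 5!case: (e v _).
Qed.

Definition spider_head s : {set T} :=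
  [set v in S | [&& v \notin s, e v (s`_0) & ~~ e v (s`_1)]].

(** Members of [spider_head] see only the centre. One that has an outside neighbour missing the
    centre starts a new leg. When there is none, the spider with its heads is a module, hence all of
    [S]; then the heads form a module too, so there is at most one. *)
Lemma spider_maximal n s : prime_set e S -> uniq s -> {subset s <= S} -> size s = n.*2.+1 ->
  2 < n -> spider_seq s ->
  exists s', [/\ uniq s', 1 < size s', spider_seq s' &
    [set x in s'] = S \/ exists v, [/\ v \notin s', v |: [set x in s'] = S,
       e v (s'`_0) & forall i, 0 < i -> i < size s' -> e v (s'`_i) = false]].
Proof.
move=> pS; have [m] := ubnP (#|S| - n); elim: m n s => // m IH n s Sm us sS sn n2 hs.
have n1 : 1 < n by apply: ltnW.
have type v : v \notin s -> exists a b,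
    [/\ e v (s`_0) = a, forall i, 0 < i -> i < size s -> e v (s`_i) = b & b ==> a].
  exact: spider_type n1 hs.
have s1 : 1 < size s by rewrite sn; lia.
set E := spider_head s.
have ET v i : v \in E -> 0 < i -> i < size s -> e v (s`_i) = false.
  rewrite inE => /and4P[_ /type[a [b [_ Hb _]]] _ /negbTE f1] i0 is_.
  by rewrite Hb // -(Hb 1).
have [[v [a [vE aS as_ [ea0 eav]]]]|no] :=
    EM (exists v a, [/\ v \in E, a \in S, a \notin s & e a (s`_0) = false /\ e a v]).
  have [vS vs ev0] : [/\ v \in S, v \notin s & e v (s`_0)] by move: vE; rewrite inE => /and4P[].
  have va : v != a by apply/eqP => va; rewrite va ea0 in ev0.
  have aT i : i < size s -> e a (s`_i) = false.
    have [a' [b [Ha Hb ba]]] := type a as_; case: i => [|i] is_; first by rewrite ea0.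
    by rewrite Hb //; move: ba; rewrite -Ha ea0 implybF => /negbTE.
  apply: (IH n.+1 (rcons (rcons s v) a)).
  - have : n.+1.*2.+1 <= #|S|.
      have <- : #|[set x in rcons (rcons s v) a]| = n.+1.*2.+1.
        rewrite cardsE; have /card_uniqP -> : uniq (rcons (rcons s v) a).
          by rewrite !rcons_uniq mem_rcons in_cons negb_or eq_sym va as_ vs us.
        by rewrite !size_rcons sn.
      apply: subset_leq_card; apply/subsetP => z; rewrite inE.
      by rewrite !(mem_rcons, in_cons) => /or3P[/eqP ->|/eqP ->|/sS].
    by lia.
  - by rewrite !rcons_uniq mem_rcons in_cons negb_or eq_sym va as_ vs us.
  - by move=> z; rewrite !(mem_rcons, in_cons) => /or3P[/eqP ->|/eqP ->|/sS].
  - by rewrite !size_rcons sn.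
  - exact: ltnW.
  - apply/spider_seqP => i j ij; rewrite !size_rcons ltnS => jn.
    move/spider_seqP: hs => hs.
    rewrite !nth_rcons !size_rcons.
    have [js|sj] := ltnP j (size s).
      have is_ := ltn_trans ij js.
      by rewrite is_ (ltnW js : j < (size s).+1) (ltnW is_ : i < (size s).+1) hs.
    have [jE|jv] := eqVneq j (size s).
      rewrite jE ltnSn; have is_ : i < size s by rewrite -jE.
      rewrite (ltnW is_ : i < (size s).+1) is_ /spider_rel sn eqSS.
      case: i ij is_ => [|i] ij is_; first by rewrite ev0 /= odd_double.
      rewrite ET //=; case: eqP => //= E1; by rewrite -[LHS](odd_double n) E1.
    have jE : j = (size s).+1 by apply/eqP; rewrite eqn_leq jn ltn_neqAle eq_sym jv sj.
    rewrite jE in ij *.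
    rewrite ltnn eqxx /spider_rel; have [iv|iv] := eqVneq i (size s).
      by rewrite iv ltnSn ltnn eqxx eav sn /= odd_double.
    have is_ : i < size s by rewrite ltn_neqAle iv -ltnS.
    rewrite (ltnW is_ : i < (size s).+1) is_ aT // eqSS [size s == i]eq_sym (ltn_eqF is_).
    by rewrite sn /= odd_double andbF.
exists s; split=> //.
have XE : [set x in s] :|: E = S.
  apply: (prime_module_eq pS); last first.
    apply: leq_trans (subset_leq_card (subsetUl _ _)).
    by rewrite cardsE; move/card_uniqP: us => ->.
  split=> [|]; first by apply/subsetP => z; rewrite !inE => /orP[/sS|/and4P[]].
  suff H z : z \in S -> z \notin [set x in s] :|: E ->
      exists b, forall x, x \in [set x in s] :|: E -> e z x = b.
    by move=> x y z xM yM zS /(H z zS)[b Hb]; rewrite !Hb.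
  move=> zS; rewrite !inE zS negb_or /= => /andP[zs]; rewrite zs /= negb_and negbK => zE.
  have [a [b [Ha Hb ba]]] := type z zs.
  have eab : a = b.
    move: zE ba; rewrite Ha (Hb 1) //; by case: a {Ha}; case: b {Hb}.
  exists b => x /setUP[|xE].
    rewrite inE => xs; rewrite -(nth_index x0 xs).
    case: (posnP (index x s)) => [->|i0]; first by rewrite Ha.
    by rewrite Hb // index_mem.
  (* An outside vertex complete to the spider sees every head, by [spider7_centre_complete] on three
     legs; one that sees none of the spider sees no head, as no new leg exists. *)
  case: b {ba} eab Hb => eab Hb.
    apply: contrapT => /negP/negbTE ezx; move/negP: spider7_centre_complete; apply.
    have [xS xs ex0] : [/\ x \in S, x \notin s & e x (s`_0)] by move: xE; rewrite inE => /and4P[].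
    have s7 : 7 <= size s by rewrite sn; lia.
    have xz : x != z.
      by apply/eqP => xz; move: (ET _ 1 xE isT s1); rewrite xz Hb.
    have nth7 (P : T -> bool) w : size w = 7 ->
        (forall i, i < 7 -> P (s`_i) = nth false w i) -> [seq P x | x <- take 7 s] = w.
      move=> w7 H; apply: (@eq_from_nth _ false); rewrite size_map size_takel // => i i7.
      by rewrite (nth_map x0) ?size_takel // nth_take // H.
    have m7 : mat e (take 7 s) = spider_mat false 7.
      by rewrite -take_mat // hs sn /spider_mat; apply/(eq_from_nth (x0 := [::]));
        rewrite ?size_takel ?size_mkseq -?sn // => i i7; rewrite nth_take // !nth_mkseq // (leq_trans i7).
    have := @sparsem_mat _ x0 e e_sym (rcons (take 7 s) x) z spe.
    rewrite !mat_rcons m7 map_rcons ezx.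
    have lt7 i : i < 7 -> i < size s by move=> i7; apply: leq_trans s7.
    have -> : [seq e x y | y <- take 7 s] = true :: nseq 6 false.
      apply: nth7 => // -[|i] i6; first exact: ex0.
      by rewrite ET ?lt7 // -[RHS]/(nth false (nseq 6 false) i) nth_nseq if_same.
    have -> : [seq e z y | y <- take 7 s] = nseq 7 true.
      apply: nth7 => // -[|i] i6; first by rewrite Ha eab.
      by rewrite Hb ?lt7 // nth_nseq i6.
    apply; rewrite !rcons_uniq mem_rcons in_cons negb_or eq_sym xz take_uniq //.
    by rewrite !(contra (@mem_take _ _ _ _)).
  apply/negP => ezx; apply: no; exists x, z; split => //; split => //.
  by rewrite Ha eab.
have [E0|[v vE]] := set_0Vmem E.
  by left; rewrite -XE E0 setU0.
right; exists v.
have [vS vs ev0] : [/\ v \in S, v \notin s & e v (s`_0)] by move: vE; rewrite inE => /and4P[].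
split=> //; last by move=> i; apply: ET.
suff <- : E = [set v] by rewrite setUC.
have [c1|c1] := leqP #|E| 1.
  apply/eqP; rewrite eq_sym eqEcard sub1set vE.
  by rewrite cards1.
have /setP/(_ s`_0) : E = S.
  apply: (prime_module_eq pS) => //; split=> [|x y z xE yE].
    by apply/subsetP => z; rewrite inE => /and4P[].
  rewrite -{1}XE => /setUP[|-> //]; rewrite inE => zs _.
  rewrite -(nth_index x0 zs) ![e (s`_ _) _]e_sym.
  have iz : index z s < size s by rewrite index_mem.
  case: (posnP (index z s)) => [->|i0]; last by rewrite !ET.
  by move: xE yE; rewrite !inE => /and4P[_ _ -> _] /and4P[_ _ -> _].
have s0 : s`_0 \in s by rewrite mem_nth // ltnW.
by rewrite inE s0 (sS _ s0).
Qed.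
End Spiders.

(** * Sparse graphs *)

Section SparseGraphs.
Variable G : sgraph.

Lemma iso_induced (a : rel 'I_5) (a_sym : symmetric a) (a_irr : irreflexive a) (t : seq G) :
  uniq t -> size t = 5 ->
  (forall x0 (i j : 'I_5), i < j -> adj (nth x0 t j) (nth x0 t i) = a i j) ->
  iso (induced [set x in t]) (SGraph a_sym a_irr).
Proof.
move=> ut t5 H; pose f (x : induced [set x in t]) : 'I_5 := inord (index (val x) t).
have it (x : induced [set x in t]) : index (val x) t < 5.
  by rewrite -t5 index_mem; have := valP x; rewrite inE.
have fE x : f x = index (val x) t :> nat by rewrite inordK.
have fK x0 x : nth x0 t (f x) = val x.
  by rewrite fE nth_index //; have := valP x; rewrite inE.
exists f.
  apply: inj_card_bij => [x y /(congr1 val) /= E|].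
    by apply: val_inj; rewrite -(fK (val x) x) -(fK (val x) y) /= E.
  rewrite card_ord card_sig -[5]t5 -(card_uniqP ut).
  by apply/subset_leq_card/subsetP => x; rewrite !inE.
move=> x y; rewrite -[RHS]/(adj (val x) (val y)).
have [z Ez] : exists z : G, z = val x by exists (val x).
rewrite -(fK z x) -(fK z y).
have [E|xy] := eqVneq (f x) (f y); first by rewrite E !adj_irr.
have := xy; rewrite -val_eqE neq_ltn => /orP[lt|lt].
  by rewrite [RHS]adj_sym H.
by rewrite H // -[LHS]/(a (f x) (f y)) a_sym.
Qed.

Lemma bad_induces x0 (t : seq G) : uniq t -> size t = 5 -> bad (mat x0 (@adj G) t) ->
  induces_P5_coP5_Bull [set x in t].
Proof.
move=> ut t5 b.
have main (a : rel 'I_5) (a_sym : symmetric a) (a_irr : irreflexive a) (phi : nat -> nat -> bool) :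
    (forall i j : 'I_5, i < j -> phi i j = a i j) ->
    contains (mat x0 (@adj G) t) (mkm phi 5) ->
    iso (induced [set x in t]) (SGraph a_sym a_irr).
  move=> E /(containsP (@adj_sym G) ut)[s ps H].
  have -> : [set x in t] = [set x in s] by apply/setP => x; rewrite !inE (perm_mem ps).
  apply: iso_induced; rewrite ?(perm_uniq ps) ?(perm_size ps) // => x1 i j ij.
  have sz k : (k : 'I_5) < size s by rewrite (perm_size ps) t5.
  by rewrite !(set_nth_default x0 x1) // (mat_mkm H) ?E.
have ord5 (P : 'I_5 -> Prop) : P ord0 -> P (@Ordinal 5 1 isT) -> P (@Ordinal 5 2 isT) ->
    P (@Ordinal 5 3 isT) -> P (@Ordinal 5 4 isT) -> forall i, P i.
  move=> p0 p1 p2 p3 p4 [[|[|[|[|[|i]]]]] Hi] //; [move: p0|move: p1|move: p2|move: p3|move: p4];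
    by congr P; apply: val_inj.
case/or3P: b => b; [constructor 1|constructor 2|constructor 3].
- by apply: main b; do 2![elim/ord5].
- by apply: main b; do 2![elim/ord5].
- by apply: main b; do 2![elim/ord5].
Qed.

(** Two bad 5-sets sharing four vertices have a union of six vertices, in which sparseness would
    identify them. *)
Lemma sparse_graph x0 : P5_coP5_Bull_sparse G -> sparse x0 (@adj G).
Proof.
move=> spG t1 t2 u1 u2 s1 s2 b1 b2; apply/eqP => c4.
have card_set (t : seq G) : uniq t -> #|[set x in t]| = size t.
  by move=> ut; rewrite cardsE; apply/card_uniqP.
have cI : #|[set x in t1] :&: [set x in t2]| = 4.
  rewrite -c4 -size_filter -card_set ?filter_uniq //; congr #|pred_of_set _|.
  by apply/setP => x; rewrite !inE mem_filter andbC.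
have cU : #|[set x in t1] :|: [set x in t2]| = 6.
  by rewrite cardsU cI !card_set // s1 s2.
have E := spG _ cU _ _ (subsetUl _ _) (etrans (card_set _ u1) s1) (bad_induces u1 s1 b1)
              (subsetUr _ _) (etrans (card_set _ u2) s2) (bad_induces u2 s2 b2).
by move: cI; rewrite E setIid card_set // s2.
Qed.
End SparseGraphs.

(** * Construction of sparse prime sets and reduction to them *)

Section PrimeSets.
Variables (T : finType) (x0 : T) (e : rel T) (S : {set T}).
Hypotheses (e_sym : symmetric e) (e_irr : irreflexive e).
Hypotheses (spe : sparse x0 e) (pS : prime_set e S).
Local Notation mat := (mat x0).

Definition prime_seq s := [/\ uniq s, {subset s <= S} & prime_set e [set x in s]].

Lemma prime_seq_perm s s' : perm_eq s' s -> prime_seq s -> prime_seq s'.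
Proof.
move=> ps [us sS pr]; split; first by rewrite (perm_uniq ps).
  by move=> x; rewrite (perm_mem ps) => /sS.
by have -> : [set x in s'] = [set x in s] by apply/setP => x; rewrite !inE (perm_mem ps).
Qed.

Lemma prime_seq_contains s phi n : prime_seq s -> contains (mat e s) (mkm phi n) ->
  exists s', [/\ prime_seq s', size s' = n & mat e s' = mkm phi n].
Proof.
move=> ps /(containsP e_sym (let: And3 us _ _ := ps in us))[s' pp E].
exists s'; split => //; first exact: prime_seq_perm ps.
by rewrite -(size_mat x0 e) E size_mkseq.
Qed.

Lemma prime_seq_step (ck : seq (seq bool) -> bool) s :
  (forall t v, uniq (rcons t v) -> {subset rcons t v <= S} -> ck (mat e (rcons t v))) ->
  prime_seq s -> 2 < size s -> size s + 2 <= #|S| ->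
  exists s', [/\ prime_seq s', size s' = size s + 2 & mat e s' \in ext2 ck (mat e s)].
Proof.
move=> ckP [us sS pr] s2 sS2; set X := [set x in s].
have cX : #|X| = size s by rewrite cardsE; apply/card_uniqP.
have XS : X \subset S by apply/subsetP => x; rewrite inE => /sS.
have cD : 1 < #|S :\: X| by rewrite cardsD (setIidPr XS) cX; lia.
have cX2 : 2 < #|X| by rewrite cX.
have [x [y [xD yD xy pxy]]] := prime_add2 e_sym pS pr XS cX2 cD.
move: xD yD; rewrite !inE => /andP[xs xS] /andP[ys yS].
have done_ a b : (a == x) && (b == y) || (a == y) && (b == x) ->
    mat e (rcons (rcons s a) b) \in ext2 ck (mat e s) ->
    exists s', [/\ prime_seq s', size s' = size s + 2 & mat e s' \in ext2 ck (mat e s)].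
  move=> ab H; exists (rcons (rcons s a) b); split=> //; last by rewrite !size_rcons addn2.
  have ab' : [/\ a != b, a \in S, b \in S, a \notin s & b \notin s].
    by case/orP: ab => /andP[/eqP -> /eqP ->]; rewrite // eq_sym.
  case: ab' => neq aS bS as_ bs; split.
  - by rewrite !rcons_uniq mem_rcons in_cons negb_or eq_sym neq as_ bs us.
  - by move=> z; rewrite !(mem_rcons, in_cons) => /or3P[/eqP ->|/eqP ->|/sS].
  - have -> : [set z in rcons (rcons s a) b] = x |: (y |: X); last exact: pxy.
    apply/setP => z; rewrite !inE !(mem_rcons, in_cons).
    case/orP: ab => /andP[/eqP -> /eqP ->] //; exact: orbCA.
case: (mem_ext2 e_sym ckP xy xS yS xs ys us sS pxy); apply: done_; rewrite !eqxx ?orbT //.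
Qed.

Lemma shape_flag phi c s : mat (flag_rel e c) s = mkm phi (size s) -> shape e phi c s.
Proof.
move=> /matP H x1 i j ij js.
rewrite !(set_nth_default x0 x1) // ?(ltn_trans ij js) //.
by have := H i j ij js; rewrite /flag_rel => <-; rewrite addbA addbb.
Qed.

Lemma spider_built c s : prime_seq s -> size s = 7 -> mat e s = spider_mat c 7 ->
  exists l : T -> 'I_16, built e S l.
Proof.
move=> [us sS pr] s7 ms.
have [s' [us' s1 hs' cases]] := @spider_maximal _ x0 _ S (flag_sym c e_sym) (@flag_sparse _ _ _ c spe)
    3 s (iffRL (flag_prime_set e c S) pS) us sS s7 isT
    (etrans (flag_mat ms s7) (congr1 _ (esym s7))).
have [l [B Bl]] := built_spider e_sym e_irr us' (ltnW s1) (shape_flag hs').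
case: cases => [<-|[v [vs <- v0 vi]]]; first by exists l.
(* The remaining vertex takes label 3, free again at the end, and is joined to the centre's label 0,
   or to all other labels in the complement. *)
eexists; apply: (built_add (new := @Ordinal 16 3 isT)
  (f := fun j => c (+) (j == @Ordinal 16 0 isT)) e_sym _ _ _ _ B) => //.
- by rewrite inE.
- move=> x; rewrite inE => xs; rewrite -(nth_index x0 xs) Bl ?index_mem //.
  by do 2?case: ifP.
- move=> x; rewrite inE => xs; rewrite -(nth_index x0 xs).
  have ix : index x s' < size s' by rewrite index_mem.
  rewrite Bl //; case: (posnP (index x s')) => [->|i0] /=.
    by move: v0; rewrite /flag_rel; case: (c); case: (e _ _).
  by move: (vi _ i0 ix); rewrite /flag_rel; case: ifP => _; case: (c); case: (e _ _).
Qed.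

Lemma half_built c s : good_on e S -> prime_seq s -> size s = 6 -> mat e s = half_mat c 6 ->
  exists l : T -> 'I_16, built e S l.
Proof.
move=> gd [us sS pr] s6 ms.
have ph : prime_half_seq x0 (flag_rel e c) S 3 s.
  split=> //; first by rewrite /half_seq s6; apply: flag_mat.
  exact/flag_prime_set.
have [s' [us' s0 hs' <-]] := half_maximal (flag_sym c e_sym) (@flag_good _ _ c S gd) (isT : 2 < 3)
   (iffRL (flag_prime_set e c S) pS) ph.
exact: built_half (shape_flag hs').
Qed.

Lemma prime_built : 0 < #|S| -> exists l : T -> 'I_16, built e S l.
Proof.
(* From eleven vertices on, the growth 5, 7, 9, 11 is available, and its last step contradicts
   [starts_growth] unless a spider occurs. *)
move=> S0; have [S10|S11] := leqP #|S| 10.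
  have -> : S = [set x in enum S] by apply/setP => x; rewrite inE mem_enum.
  by apply: built_small; rewrite ?enum_uniq // -cardE S0; lia.
have cks t v : uniq (rcons t v) -> {subset rcons t v <= S} -> sparsem (mat e (rcons t v)).
  by move=> ut _; apply: sparsem_mat.
have [[t [pt t5]]|no] := EM (exists t, prime_seq t /\ size t = 5).
  have [ut tS pr] := pt.
  have [st [t' [stE pt' t5' mt']]] : exists st t', [/\ st \in starts, prime_seq t',
      size t' = 5 & mat e t' = st].
    have mt : mat e t = mkm (fun i j => e (nth x0 t j) (nth x0 t i)) 5 by rewrite -t5.
    set phi := fun i j => _ in mt.
    have b10 : flatten (mkm phi 5) \in bits 10 by rewrite mem_bits size_flatten_mkm.
    have := allP prime5_contains_start _ b10.
    rewrite unflat5K -/(fprime _) fprimeE -mt (introT (mprimeP x0 e_sym ut) pr) /=.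
    rewrite !orbF => H.
    have sub m : m \in starts -> contains (mat e t) m -> exists st t', [/\ st \in starts,
        prime_seq t', size t' = 5 & mat e t' = st].
      move=> ms H'; exists m.
      have [s' [ps' s5' E]] : exists s', [/\ prime_seq s', size s' = 5 & mat e s' = m].
        by move: ms H'; rewrite !inE => /or4P[] /eqP ->; apply: prime_seq_contains.
      by exists s'.
    by case/or4P: H; apply: sub; rewrite !inE eqxx ?orbT.
  have [||s7 [p7 z7 m7]] := prime_seq_step cks pt'; try (rewrite t5'; lia).
  rewrite t5' in z7; rewrite mt' in m7.
  have inL : mat e s7 \in flatten (map (ext2 sparsem) starts).
    by apply/flattenP; exists (ext2 sparsem st) => //; apply: map_f.
  have [sp|nsp] := boolP (spider7 (mat e s7)).
    have [c Hc] : exists c, contains (mat e s7) (spider_mat c 7).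
      by case/orP: sp => ?; [exists false|exists true].
    have [s' [ps' s7' ms']] := prime_seq_contains p7 Hc.
    exact: spider_built ps' s7' ms'.
  have := allP starts_growth _ inL; rewrite (negPf nsp) /= => /allP H9.
  have [||s9 [p9 z9 m9]] := prime_seq_step cks p7; try (rewrite z7; lia).
  rewrite z7 in z9.
  have [||s11 [p11 z11 m11]] := prime_seq_step cks p9; try (rewrite z9; lia).
  by have := H9 _ m9; case: (ext2 sparsem (mat e s9)) m11.
have gd : good_on e S by move=> t ut t5 tS pr; apply: no; exists t.
have ckg t v : uniq (rcons t v) -> {subset rcons t v <= S} -> goodm (mat e (rcons t v)).
  exact: goodm_mat.
have S2 : 2 < #|S| by lia.
have [c [p [q [r [s [[pS' qS rS sS] [u4 [pq qr rs [pr ps qs]]]]]]]]] := prime_has_P4 e_sym S2 pS.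
(* In this order the path [p q r s] becomes the half graph on four vertices. *)
have u4' : uniq [:: q; p; s; r].
  move: u4; rewrite /= !inE !negb_or !andbT.
  move=> /and3P[/and3P[npq npr nps] /andP[nqr nqs] nrs].
  by rewrite [q == p]eq_sym [s == r]eq_sym npq npr nps nqr nqs nrs.
have m4 : mat e [:: q; p; s; r] = half_mat c 4.
  apply/(matP x0 _ e [:: q; p; s; r]) => i j ij /= j4.
  case: j ij j4 => [|[|[|[|j]]]] //; case: i => [|[|[|i]]] // _ _ /=.
  - by rewrite pq; case: (c).
  - by rewrite e_sym qs; case: (c).
  - by rewrite e_sym ps; case: (c).
  - by rewrite e_sym qr; case: (c).
  - by rewrite e_sym pr; case: (c).
  - by rewrite rs; case: (c).
have p4 : prime_seq [:: q; p; s; r].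
  split => //; first by move=> x; rewrite !inE => /or4P[] /eqP ->.
  by apply/(mprimeP x0 e_sym u4'); rewrite m4; case: (c); vm_compute.
have h6 : 4 + 2 <= #|S| by apply: leq_trans S11.
have [s6 [p6 z6 m6]] := prime_seq_step ckg p4 isT h6.
rewrite m4 in m6.
have cB : c \in [:: false; true] by case: (c).
have := allP (allP P4_growth _ cB) _ m6.
have half c' : contains (mat e s6) (half_mat c' 6) -> exists l : T -> 'I_16, built e S l.
  move=> /(prime_seq_contains p6)[s' [ps' s6' ms']]; exact: half_built gd ps' s6' ms'.
by case/orP; apply: half.
Qed.
End PrimeSets.

(** Induction on the size by [built_module]: a nontrivial module and the quotient that keeps one of
    its vertices are both smaller. Since [sparse] speaks of all of [T], it covers every subset. *)
Lemma sparse_built (T : finType) (x0 : T) (e : rel T) (S : {set T}) :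
  symmetric e -> irreflexive e -> sparse x0 e -> 0 < #|S| ->
  exists l : T -> 'I_16, built e S l.
Proof.
move=> e_sym e_irr spe; have [n] := ubnP #|S|; elim: n S => // n IH S Sn S0.
have [pS|] := EM (prime_set e S); first exact: (prime_built e_sym e_irr spe pS S0).
move=> /existsNP[M /not_implyP[mM /not_orP[/negP]]]; rewrite -ltnNge => M1 MS.
have [m mM'] : exists m, m \in M by apply/card_gt0P; lia.
have sub : M \subset S by case: mM.
have ltM : #|M| < #|S|.
  by apply: proper_card; rewrite properEneq sub andbT; apply/eqP.
have [l1 B1] : exists l : T -> 'I_16, built e (m |: (S :\: M)) l.
  apply: IH; last by apply/card_gt0P; exists m; rewrite !inE eqxx.
  rewrite cardsU1 !inE mM' /= cardsD (setIidPr sub); lia.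
have [l2 B2] : exists l : T -> 'I_16, built e M l by apply: IH; lia.
exact: built_module e_sym mM mM' B1 B2.
Qed.

Theorem mainTheorem5 :
  exists k : nat, forall G : sgraph,
    P5_coP5_Bull_sparse G -> clique_width G <= k.
Proof.
exists 16 => G spG; have [G0|/card_gt0P[x0 _]] := posnP #|G|.
  (* The empty graph has clique-width 0 by convention. *)
  rewrite /clique_width; case: ex_minnP => m _ /(_ 0) H.
  by apply: leq_trans (H _) _ => //; apply/asboolP; left.
have [|l B] := @sparse_built G x0 (@adj G) [set: G] (@adj_sym G) (@adj_irr G) (@sparse_graph G x0 spG).
  by apply/card_gt0P; exists x0; rewrite inE.
exact: built_clique_width B.
Qed.
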